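(* Let $(\Gamma,\mathcal X)$ be an initial state of the MEV game, i.e. $\Gamma$ is a reachable state not containing the wallet of the adversary $\mathsf M$ and $\mathcal X$ is a finite multiset of user transactions, under the assumptions on the game listed in the context. Then: 1. If $\mathcal X$ is empty, the solution to the MEV game $(\Gamma,\mathcal X)$ is the final layer constructed for $(\Gamma,[\,])$ (defined in the context). 2. Otherwise, if $\mathcal X=[\mathsf T]+\mathcal X'$ (multiset sum), let $(\sigma,\lambda)$ be the inner layer constructed for $(\Gamma,[\mathsf T])$ (defined in the context), let $\mathsf M[\sigma]\mid\Gamma\xrightarrow{\lambda}\mathsf M[\_]\mid\Gamma'$, and let $(\sigma',\lambda')$ be the solution to the MEV game $(\Gamma',\mathcal X')$. Then the solution to the MEV game $(\Gamma,\mathcal X)$ is $(\sigma+\sigma',\lambda\lambda')$ (pointwise sum of balances, concatenation of sequences).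
   Context: **Tokens, wallets, states.** $\mathbb T_0$ is a set of atomic token types; $\mathbb T_1=\mathbb T_0\times\mathbb T_0$ is the set of minted token types; $\mathbb T=\mathbb T_0\cup\mathbb T_1$. A wallet is a term $\mathsf A[\sigma]$, with $\mathsf A$ a user and $\sigma:\mathbb T\rightharpoonup\mathbb R_{\ge0}$ a partial map (token types outside $\operatorname{dom}\sigma$ count as balance $0$); $\mathsf A[\_]$ denotes a wallet with unspecified balance. An AMM is a pair $(r_0:\tau_0,r_1:\tau_1)$ with $\tau_0\neq\tau_1\in\mathbb T_0$ and $r_0,r_1\in\mathbb R_{\ge0}$ (its reserves). A state is a finite composition (unordered, written with $\mid$) of wallets of distinct users and AMMs, where distinct AMMs do not hold the same two token types. The supply $\mathit{sply}_\tau(\Gamma)$ is the total amount of $\tau$ in all wallets and AMMs of $\Gamma$. **Transactions** ($\Gamma\xrightarrow{\mathsf T}\Gamma'$; everything not mentioned is unchanged). - *Deposit, new AMM*: $\mathsf A:\mathsf{dep}(v_0:\tau_0,v_1:\tau_1)$ with $\tau_0\ne\tau_1\in\mathbb T_0$, no AMM on $\tau_0,\tau_1$ (in either order) in $\Gamma$, and $\sigma_{\mathsf A}(\tau_i)\ge v_i>0$ for $i=0,1$: $\mathsf A$ pays $v_0:\tau_0$ and $v_1:\tau_1$, receives $v_0:(\tau_0,\tau_1)$, and the AMM $(v_0:\tau_0,v_1:\tau_1)$ is created. - *Deposit, existing AMM* $(r_0:\tau_0,r_1:\tau_1)$: $\mathsf A:\mathsf{dep}(v_0:\tau_0,v_1:\tau_1)$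 with $\sigma_{\mathsf A}(\tau_i)\ge v_i>0$ and $r_1v_0=r_0v_1$: $\mathsf A$ pays $v_0:\tau_0,v_1:\tau_1$ and receives $\frac{v_0}{r_0}\mathit{sply}_{(\tau_0,\tau_1)}(\Gamma)$ units of $(\tau_0,\tau_1)$; the AMM becomes $(r_0+v_0:\tau_0,r_1+v_1:\tau_1)$. - *Swap* ($d\in\{0,1\}$) on AMM $(r_0:\tau_0,r_1:\tau_1)$: $\mathsf A:\mathsf{swap}^d(v_0:\tau_0,v_1:\tau_1)$ with $\sigma_{\mathsf A}(\tau_d)\ge v_d>0$, $v=\frac{r_{1-d}v_d}{r_d+v_d}$ and $0<v_{1-d}\le v$: $\mathsf A$ pays $v_d:\tau_d$ and receives $v:\tau_{1-d}$; the reserve of $\tau_d$ increases by $v_d$ and that of $\tau_{1-d}$ decreases by $v$. - *Redeem* on AMM $(r_0:\tau_0,r_1:\tau_1)$: $\mathsf A:\mathsf{rdm}(v:(\tau_0,\tau_1))$ with $\sigma_{\mathsf A}(\tau_0,\tau_1)\ge v>0$ and $v_i=v\,r_i/\mathit{sply}_{(\tau_0,\tau_1)}(\Gamma)$: $\mathsf A$ pays $v:(\tau_0,\tau_1)$ and receives $v_0:\tau_0$, $v_1:\tau_1$, which are subtracted from the reserves. For a sequence $\lambda$ of transactions, $\Gamma\xrightarrow{\lambda}\Gamma'$ is the composition of the steps; $\lambda$ is enabled in $\Gamma$ if such a $\Gamma'$ exists. $\Gamma$ is reachable if $\Gamma_0\xrightarrow{\lambda}\Gamma$ for some $\lambda$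 and some $\Gamma_0$ consisting only of wallets holding only atomic tokens. Reserves of AMMs are assumed never to be reduced to zero in an execution. **Prices, gain.** Prices of atomic tokens are given by a fixed $P:\mathbb T_0\to\mathbb R_{\ge0}$; for $\tau\in\mathbb T_0$ put $P_\Gamma(\tau)=P(\tau)$, and for an AMM $(r_0:\tau_0,r_1:\tau_1)$ in $\Gamma$ put $P_\Gamma(\tau_0,\tau_1)=\frac{r_0P(\tau_0)+r_1P(\tau_1)}{\mathit{sply}_{(\tau_0,\tau_1)}(\Gamma)}$. The net worth of $\mathsf A$ with $\mathsf A[\sigma]$ in $\Gamma$ is $W_{\mathsf A}(\Gamma)=\sum_{\tau\in\operatorname{dom}\sigma}\sigma(\tau)P_\Gamma(\tau)$, and the gain is $G_{\mathsf A}(\Gamma,\lambda)=W_{\mathsf A}(\Gamma')-W_{\mathsf A}(\Gamma)$ if $\Gamma\xrightarrow{\lambda}\Gamma'$ (and $0$ if $\lambda$ is not enabled in $\Gamma$). **MEV game.** The initial state is $(\Gamma,\mathcal X)$: $\Gamma$ a reachable state without the wallet of the adversary $\mathsf M$, and $\mathcal X$ a finite multiset of user transactions (the pool of pending transactions). A move is a pair $(\sigma,\lambda)$, where $\sigma$ is $\mathsf M$'s initial balance and $\lambda$ is a sequence formed by (part of) the transactions in $\mathcal X$ and by any number of transactions of $\mathsf M$, such that $\lambda$ is enabled in $\mathsf M[\sigma]\mid\Gamma$. A solution is a move maximizing $G_{\mathsf M}(\mathsf M[\sigma]\mid\Gamma,\lambda)$. Assumptions: user balances in $\Gamma$ are sufficiently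 high to not interfere with the validity of any specific ordering of the transactions in $\mathcal X$; the balance $\sigma$ of $\mathsf M$ does not include minted tokens; the length of $\lambda$ is unbounded; prices of atomic tokens are fixed throughout the game; there are no swap fees and no transaction fees. **Final layer for $(\Gamma,[\,])$.** For an AMM $(r_0:\tau_0,r_1:\tau_1)$ in $\Gamma$ and $d\in\{0,1\}$ let $$w_d^d=\sqrt{\tfrac{P(\tau_{1-d})}{P(\tau_d)}r_0r_1}-r_d,\qquad w_{1-d}^d=\frac{r_{1-d}\,w_d^d}{r_d+w_d^d}.$$ There is at most one $d$ with $w_d^d>0$. If there is such a $d$, the AMM contributes the balance $w_d^d:\tau_d$ and the transaction $\mathsf M:\mathsf{swap}^d(w_0^d:\tau_0,w_1^d:\tau_1)$; if $w_0^0,w_1^1\le0$, it contributes the zero balance and the empty sequence. The final layer is the pair (sum of the contributed balances, concatenation of the contributed transactions, over all AMMs of $\Gamma$). **Inner layer for $(\Gamma,[\mathsf T])$**, a pair (balance of $\mathsf M$, sequence), where $\Gamma=(r_0:\tau_0,r_1:\tau_1)\mid\cdots$: - *$\mathsf T=\mathsf A:\mathsf{swap}^{a}(v_0:\tau_0,v_1:\tau_1)$.* If $-v_aP(\tau_a)+v_{1-a}P(\tau_{1-a})\ge0$, the layer is (zero balance, empty sequence). Otherwise let $$\rho_a=\frac{\sqrt{v_0^2v_1^2+4v_0v_1r_0r_1}-v_0v_1}{2v_{1-a}},\qquad \rho_{1-a}=\frac{r_0r_1}{\rho_a}.$$ If $(\rho_0,\rho_1)=(r_0,r_1)$, the layer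 is (zero balance, $\mathsf T$). Otherwise let $m\in\{0,1\}$ be the index with $\rho_m>r_m$, and set $u_m=\rho_m-r_m$, $u_{1-m}=r_{1-m}-\rho_{1-m}$; the layer is the balance $u_m:\tau_m$ together with the sequence $\mathsf M:\mathsf{swap}^m(u_0:\tau_0,u_1:\tau_1)\;\mathsf T$. - *$\mathsf T=\mathsf A:\mathsf{dep}(v_0:\tau_0,v_1:\tau_1)$.* If $v_0/v_1=r_0/r_1$, the layer is (zero balance, $\mathsf T$). Otherwise let $\rho_0=\sqrt{\tfrac{v_0}{v_1}r_0r_1}$, $\rho_1=\sqrt{\tfrac{v_1}{v_0}r_0r_1}$, and let $m\in\{0,1\}$ be the index for which $u_m=\rho_m-r_m$ and $u_{1-m}=r_{1-m}-\rho_{1-m}$ are both positive; the layer is the balance $u_m:\tau_m$ together with the sequence $\mathsf M:\mathsf{swap}^m(u_0:\tau_0,u_1:\tau_1)\;\mathsf T$. - *$\mathsf T=\mathsf A:\mathsf{rdm}(v:(\tau_0,\tau_1))$.* The layer is (zero balance, empty sequence).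
   Formalization: In item 1, the prices of both tokens of every AMM in Γ are assumed nonzero: with a zero price the final layer divides by zero, and if exactly one of the two prices is zero no gain-maximizing move exists. *)

(* Defs.v *)
From HB Require Import structures.
From mathcomp Require Import all_boot all_order all_algebra.
From mathcomp Require Import finmap multiset reals.

Set Implicit Arguments.
Unset Strict Implicit.
Unset Printing Implicit Defensive.

Import Order.TTheory GRing.Theory Num.Theory.
Local Open Scope fset_scope.
Local Open Scope fmap_scope.
Local Open Scope mset_scope.
Local Open Scope ring_scope.

(** The two tokens of an AMM, its two reserves and the two amounts of a
    transaction are pairs; an index in {0, 1} is a boolean, 0 being [false]
    (first component) and 1 being [true], so that 1 - d is [~~ d]. *)
Definition side (A : Type) (d : bool) (p : A * A) : A :=
  if d then p.2 else p.1.

(** The pair with [x] on side [d] and [y] on side [~~ d]. *)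
Definition on_side (A : Type) (d : bool) (x y : A) : A * A :=
  if d then (y, x) else (x, y).

Section Transactions.
Variables (R : realType) (U T0 : choiceType).

(** [Dep A t v] is A:dep(v.1:t.1, v.2:t.2), [Swap A d t v] is
    A:swap^d(v.1:t.1, v.2:t.2) and [Rdm A t v] is A:rdm(v:(t.1, t.2)). *)
Inductive tx : Type :=
| Dep of U & T0 * T0 & R * R
| Swap of U & bool & T0 * T0 & R * R
| Rdm of U & T0 * T0 & R.

Definition owner (T : tx) : U :=
  match T with Dep A _ _ => A | Swap A _ _ _ => A | Rdm A _ _ => A end.

(** Multisets of transactions require a choiceType. *)
Definition tx_code : Type :=
  (U * (T0 * T0) * (R * R)
   + (U * bool * (T0 * T0) * (R * R) + U * (T0 * T0) * R))%type.

Definition tx_encode (T : tx) : tx_code :=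
  match T with
  | Dep A t v => inl (A, t, v)
  | Swap A d t v => inr (inl (A, d, t, v))
  | Rdm A t v => inr (inr (A, t, v))
  end.

Definition tx_decode (c : tx_code) : tx :=
  match c with
  | inl (A, t, v) => Dep A t v
  | inr (inl (A, d, t, v)) => Swap A d t v
  | inr (inr (A, t, v)) => Rdm A t v
  end.

Lemma tx_encodeK : cancel tx_encode tx_decode.
Proof. by case. Qed.

HB.instance Definition _ := Choice.copy tx (can_type tx_encodeK).

End Transactions.

Section States.
Variables (R : realType) (U T0 : choiceType).

(** [inl a] is an atomic token, [inr (a, b)] a minted one. *)
Definition token : choiceType := (T0 + T0 * T0)%type.

(** Finitely supported, tokens outside the support having balance 0. *)
Definition balance : Type := {fsfun token -> R with 0}.

Definition bzero : balance := [fsfun].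

Definition badd (sg sg' : balance) : balance :=
  [fsfun x in (finsupp sg `|` finsupp sg')%fset => sg x + sg' x].

(** The balance v:x. *)
Definition bsingle (x : token) (v : R) : balance :=
  [fsfun bzero with x |-> v].

(** [v] may be negative, for a payment. *)
Definition credit (sg : balance) (x : token) (v : R) : balance :=
  [fsfun sg with x |-> sg x + v].

Definition atomic_balance (sg : balance) : Prop :=
  (forall x, 0 <= sg x) /\ (forall t, sg (inr t) = 0).

(** The keys of the first map are the users having a wallet, those of the
    second one the token pairs of the AMMs, mapped to their reserves. That
    balances and reserves are nonnegative, that the two tokens of an AMM are
    distinct and that distinct AMMs do not hold the same two tokens is true of
    initial states and preserved by transactions, hence holds of every
    reachable state. *)
Record state : Type := State {
  wallets : {fmap U -> balance};
  amms : {fmap T0 * T0 -> R * R}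
}.

Implicit Types (G : state) (A M : U) (t : T0 * T0) (T : tx R U T0)
  (X : {mset tx R U T0}) (lam : seq (tx R U T0)).

Definition bal G A : balance := odflt bzero (wallets G).[? A].

Definition reserves G t : R * R := odflt (0, 0) (amms G).[? t].

(** If [M] has no wallet in [G], this is the state M[sg] | G. *)
Definition set_wallet G M (sg : balance) : state :=
  State (wallets G).[M <- sg] (amms G).

Definition sply G (x : token) : R :=
  \sum_(A <- domf (wallets G)) bal G A x +
  \sum_(t <- domf (amms G))
    (((inl t.1 == x)%:R * (reserves G t).1) +
     ((inl t.2 == x)%:R * (reserves G t).2)).

(** Writes the wallet of [A] and the AMM [t]; undefined if this would leave the
    AMM with a zero reserve, which executions never do. *)
Definition update G A (sg : balance) t (r : R * R) : option state :=
  if (0 < r.1) && (0 < r.2)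
  then Some (State (wallets G).[A <- sg] (amms G).[t <- r])
  else None.

(** The requirement that the payer's balance covers what [T] pays. All amounts
    paid being positive in [effect], it also forces the payer to have a
    wallet. *)
Definition funded G T : bool :=
  match T with
  | Dep A t v => (v.1 <= bal G A (inl t.1)) && (v.2 <= bal G A (inl t.2))
  | Swap A d t v => side d v <= bal G A (inl (side d t))
  | Rdm A t v => v <= bal G A (inr t)
  end.

(** The transaction rules, without the premise [funded]. *)
Definition effect G T : option state :=
  match T with
  | Dep A t v =>
      let sg := credit (credit (bal G A) (inl t.1) (- v.1))
                       (inl t.2) (- v.2) in
      if (0 < v.1) && (0 < v.2) then
        if (amms G).[? t] is Some r then
          if r.2 * v.1 == r.1 * v.2 then
            update G A (credit sg (inr t) (v.1 / r.1 * sply G (inr t)))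
                   t (r.1 + v.1, r.2 + v.2)
          else None
        else if (t.1 != t.2) && ((t.2, t.1) \notin domf (amms G)) then
          update G A (credit sg (inr t) v.1) t v
        else None
      else None
  | Swap A d t v =>
      if (amms G).[? t] is Some r then
        let w := side (~~ d) r * side d v / (side d r + side d v) in
        if [&& 0 < side d v, 0 < side (~~ d) v & side (~~ d) v <= w] then
          update G A
            (credit (credit (bal G A) (inl (side d t)) (- side d v))
                    (inl (side (~~ d) t)) w)
            t (on_side d (side d r + side d v) (side (~~ d) r - w))
        else None
      else None
  | Rdm A t v =>
      if (amms G).[? t] is Some r then
        let w1 := v * r.1 / sply G (inr t) in
        let w2 := v * r.2 / sply G (inr t) in
        if 0 < v then
          update G A
            (credit (credit (credit (bal G A) (inr t) (- v)) (inl t.1) w1)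
                    (inl t.2) w2)
            t (r.1 - w1, r.2 - w2)
        else None
      else None
  end.

Definition step G T : option state :=
  if funded G T then effect G T else None.

(** [run G lam = Some G'] is G --lam--> G'; [None] means not enabled. *)
Definition run G lam : option state :=
  foldl (fun o T => obind (fun H => step H T) o) (Some G) lam.

Definition initial G : Prop :=
  amms G = [fmap] /\ (forall A, atomic_balance (bal G A)).

Definition reachable G : Prop :=
  exists G0 lam, initial G0 /\ run G0 lam = Some G.

End States.

Arguments bzero {R T0}.

Section Game.
Variables (R : realType) (U T0 : choiceType).
Variables (P : T0 -> R) (M : U).

Implicit Types (G : state R U T0) (A : U) (t : T0 * T0) (T : tx R U T0)
  (X : {mset tx R U T0}) (lam : seq (tx R U T0)) (sg : balance R T0).

(** A minted token without AMM, which nobody holds in a reachable state, gets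
    price 0. *)
Definition price G (x : token T0) : R :=
  match x with
  | inl a => P a
  | inr t =>
      if (amms G).[? t] is Some r
      then (r.1 * P t.1 + r.2 * P t.2) / sply G (inr t) else 0
  end.

Definition net_worth A G : R :=
  \sum_(x <- finsupp (bal G A)) bal G A x * price G x.

Definition gain A G lam : R :=
  if run G lam is Some G' then net_worth A G' - net_worth A G else 0.

Definition user_txs lam : seq (tx R U T0) :=
  [seq T <- lam | owner T != M].

Definition is_move G X (mv : balance R T0 * seq (tx R U T0)) : Prop :=
  [/\ atomic_balance mv.1,
      seq_mset (user_txs mv.2) `<=` X &
      run (set_wallet G M mv.1) mv.2 <> None].

Definition solution G X (mv : balance R T0 * seq (tx R U T0)) : Prop :=
  is_move G X mv /\
  forall mv', is_move G X mv' ->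
    gain M (set_wallet G M mv'.1) mv'.2 <= gain M (set_wallet G M mv.1) mv.2.

(** However the game is played, balances never are what invalidates a
    transaction of the pool which has not been executed yet. *)
Definition sufficient_balances G X : Prop :=
  forall sg lam T G',
    atomic_balance sg ->
    seq_mset (T :: user_txs lam) `<=` X ->
    run (set_wallet G M sg) lam = Some G' ->
    step G' T = effect G' T.

Definition final_amount (r : R * R) t (d : bool) : R :=
  Num.sqrt (P (side (~~ d) t) / P (side d t) * r.1 * r.2) - side d r.

Definition final_swap (r : R * R) t (d : bool)
    : balance R T0 * seq (tx R U T0) :=
  let w := final_amount r t d in
  (bsingle (inl (side d t)) w,
   [:: Swap M d t (on_side d w (side (~~ d) r * w / (side d r + w)))]).

Definition final_amm G t : balance R T0 * seq (tx R U T0) :=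
  let r := reserves G t in
  if 0 < final_amount r t false then final_swap r t false
  else if 0 < final_amount r t true then final_swap r t true
  else (bzero, [::]).

(** [ts] lists the AMMs in the order in which they are dealt with. *)
Definition final_layer G (ts : seq (T0 * T0))
    : balance R T0 * seq (tx R U T0) :=
  foldr (fun t mv => (badd (final_amm G t).1 mv.1, (final_amm G t).2 ++ mv.2))
        (bzero, [::]) ts.

Definition swap_reserves (a : bool) (v r : R * R) : R * R :=
  let rho := (Num.sqrt (v.1 ^+ 2 * v.2 ^+ 2 + 4 * v.1 * v.2 * r.1 * r.2)
              - v.1 * v.2) / (2 * side (~~ a) v) in
  on_side a rho (r.1 * r.2 / rho).

Definition dep_reserves (v r : R * R) : R * R :=
  (Num.sqrt (v.1 / v.2 * r.1 * r.2), Num.sqrt (v.2 / v.1 * r.1 * r.2)).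

(** The amounts of the swap^m leading from reserves [r] to [rho]. *)
Definition front_amounts (m : bool) (r rho : R * R) : R * R :=
  on_side m (side m rho - side m r) (side (~~ m) r - side (~~ m) rho).

Definition swap_profit (a : bool) t (v : R * R) : R :=
  - side a v * P (side a t) + side (~~ a) v * P (side (~~ a) t).

(** [inner_layer G T sg lam]: the inner layer for (G, [T]) is (sg, lam). There
    is none when [T] does not operate on an AMM of [G]. *)
Inductive inner_layer G : tx R U T0 -> balance R T0 -> seq (tx R U T0) -> Prop :=
| InnerSwapDrop A a t v r of
    (amms G).[? t] = Some r & 0 <= swap_profit a t v :
    inner_layer G (Swap A a t v) bzero [::]
| InnerSwapAlone A a t v r of
    (amms G).[? t] = Some r & swap_profit a t v < 0 & swap_reserves a v r = r :
    inner_layer G (Swap A a t v) bzero [:: Swap A a t v]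
| InnerSwapFront A a t v r m of
    (amms G).[? t] = Some r & swap_profit a t v < 0 &
    swap_reserves a v r <> r & side m r < side m (swap_reserves a v r) :
    inner_layer G (Swap A a t v)
      (bsingle (inl (side m t)) (side m (front_amounts m r (swap_reserves a v r))))
      [:: Swap M m t (front_amounts m r (swap_reserves a v r)); Swap A a t v]
| InnerDepAlone A t v r of
    (amms G).[? t] = Some r & v.1 / v.2 = r.1 / r.2 :
    inner_layer G (Dep A t v) bzero [:: Dep A t v]
| InnerDepFront A t v r m of
    (amms G).[? t] = Some r & v.1 / v.2 <> r.1 / r.2 &
    0 < side m (front_amounts m r (dep_reserves v r)) &
    0 < side (~~ m) (front_amounts m r (dep_reserves v r)) :
    inner_layer G (Dep A t v)
      (bsingle (inl (side m t)) (side m (front_amounts m r (dep_reserves v r))))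
      [:: Swap M m t (front_amounts m r (dep_reserves v r)); Dep A t v]
| InnerRdm A t v r of
    (amms G).[? t] = Some r :
    inner_layer G (Rdm A t v) bzero [::].

End Game.

(* Main.v *)
Require Import Defs.
From mathcomp Require Import all_boot all_order all_algebra.
From mathcomp Require Import finmap multiset reals ring lra.
Set Implicit Arguments.
Unset Strict Implicit.
Unset Printing Implicit Defensive.
Import Order.TTheory GRing.Theory Num.Theory.
Local Open Scope fset_scope.
Local Open Scope fmap_scope.
Local Open Scope mset_scope.
Local Open Scope ring_scope.

(** Swaps keep the product of the reserves of an AMM, while deposits and redeems
    scale its square root and the supply of the minted token by the same factor.
    Hence the AM-GM lower bound [2 * sqrt (r.1 * r.2 * P t.1 * P t.2)] on the
    value of the reserves, counted per minted token, never changes. Add to the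
    atomic tokens of the adversary the value of all reserves, minus this bound
    for the minted tokens of the users. This potential dominates the net worth
    of the adversary, with equality when each AMM has its least value for its
    product. It is constant under the adversary's own moves, and a user
    transaction raises it by at most an amount depending on this transaction
    alone: [0] for a redeem, [max 0 (- swap_profit)] for a swap, and the gap in
    AM-GM for a deposit. The inner layer raises it by exactly this amount,
    whatever the reserves are, so the order of the transactions is irrelevant.

    In the second part, the solution of the residual game is compared with moves
    playing the remaining transactions by inner layers and then rebalancing the
    AMMs. As prices may vanish, such moves are only optimal up to [eps]. As the
    competing move may have used AMMs not existing yet, they first create the
    missing AMMs. *)

(** * Balances and their linear valuations *)

Section Balances.
Variables (R : realType) (T0 : choiceType).
Implicit Types (sg : balance R T0) (x y : token T0) (p : token T0 -> R).

Lemma bzeroE x : (bzero : balance R T0) x = 0.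
Proof. by rewrite fsfun0E. Qed.

Lemma baddE sg sg' x : badd sg sg' x = sg x + sg' x.
Proof.
rewrite fsfunE inE; case: ifP => // /negbT.
by rewrite negb_or => /andP[/fsfun_dflt -> /fsfun_dflt ->]; rewrite addr0.
Qed.

Lemma bsingleE x v y : (bsingle x v : balance R T0) y = if y == x then v else 0.
Proof. by rewrite fsfun_withE bzeroE. Qed.

Lemma creditE sg x v y : credit sg x v y = sg y + (if y == x then v else 0).
Proof. by rewrite fsfun_withE; case: eqP => [->|]; rewrite ?addr0. Qed.

Lemma add0b sg : badd bzero sg = sg.
Proof. by apply/fsfunP => x; rewrite baddE bzeroE add0r. Qed.

Lemma baddA sg1 sg2 sg3 : badd (badd sg1 sg2) sg3 = badd sg1 (badd sg2 sg3).
Proof. by apply/fsfunP => x; rewrite !baddE addrA. Qed.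

Lemma baddC sg1 sg2 : badd sg1 sg2 = badd sg2 sg1.
Proof. by apply/fsfunP => x; rewrite !baddE addrC. Qed.

Lemma credit_badd sg sg' x v : credit (badd sg sg') x v = badd (credit sg x v) sg'.
Proof. by apply/fsfunP => y; rewrite !(baddE, creditE) addrAC. Qed.

Lemma credit_bsingle sg x v : credit sg x v = badd sg (bsingle x v).
Proof. by apply/fsfunP => y; rewrite baddE creditE bsingleE. Qed.

Lemma atomic_bzero : atomic_balance (bzero : balance R T0).
Proof. by split=> *; rewrite bzeroE. Qed.

Lemma atomic_badd sg sg' :
  atomic_balance sg -> atomic_balance sg' -> atomic_balance (badd sg sg').
Proof.
move=> [s0 s1] [s0' s1']; split=> *; rewrite baddE ?addr_ge0//.
by rewrite s1 s1' addr0.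
Qed.

Lemma atomic_bsingle a v : 0 <= v -> atomic_balance (bsingle (inl a) v : balance R T0).
Proof. by move=> v0; split=> *; rewrite bsingleE//; case: ifP. Qed.

(** Kept generic in the prices: [price P H] gives the net worth, [atomic_price] its atomic part, and
    the indicator of a token reads off a single balance. *)
Definition worth p sg : R := \sum_(x <- finsupp sg) sg x * p x.

Lemma worthE p sg (D : {fset token T0}) :
  (finsupp sg `<=` D)%fset -> worth p sg = \sum_(x <- D) sg x * p x.
Proof.
move=> sD; rewrite /worth; apply: big_fset_incl => // x _.
by move/fsfun_dflt => ->; rewrite mul0r.
Qed.

Lemma worth_badd p sg sg' : worth p (badd sg sg') = worth p sg + worth p sg'.
Proof.
pose D := (finsupp sg `|` finsupp sg')%fset.
rewrite (@worthE _ (badd sg sg') D); last first.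
  apply/fsubsetP => x; rewrite mem_finsupp baddE inE !mem_finsupp.
  apply: contraNT; rewrite negb_or !negbK => /andP[/eqP-> /eqP->].
  by rewrite addr0.
rewrite (@worthE _ sg D) ?fsubsetUl// (@worthE _ sg' D) ?fsubsetUr//.
by rewrite -big_split/=; apply: eq_bigr => x _; rewrite baddE mulrDl.
Qed.

Lemma worth_bsingle p x v : worth p (bsingle x v) = v * p x.
Proof.
rewrite (@worthE _ _ [fset x]%fset) ?big_seq_fset1 ?bsingleE ?eqxx//.
apply/fsubsetP => y; rewrite mem_finsupp bsingleE inE.
by case: ifP => //; rewrite eqxx.
Qed.

Lemma worth_credit p sg x v : worth p (credit sg x v) = worth p sg + v * p x.
Proof. by rewrite credit_bsingle worth_badd worth_bsingle. Qed.

Lemma worth_bzero p : worth p bzero = 0.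
Proof. by rewrite /worth big1// => x _; rewrite bzeroE mul0r. Qed.

Lemma worth_eq sg x : worth (fun y => (x == y)%:R) sg = sg x.
Proof.
rewrite (@worthE _ sg (x |` finsupp sg)%fset) ?fsubsetU1//.
rewrite (big_fsetD1 x) ?fset1U1//= eqxx mulr1.
rewrite big_seq_cond big1 ?addr0// => y; rewrite andbT 3!inE => /andP[/negPf].
by rewrite eq_sym => -> _; rewrite mulr0.
Qed.

Lemma worth_sum p (I : Type) (r : seq I) (q : I -> token T0 -> R) sg :
  worth (fun x => p x + \sum_(i <- r) q i x) sg =
  worth p sg + \sum_(i <- r) worth (q i) sg.
Proof.
rewrite /worth exchange_big/= -big_split/=; apply: eq_bigr => x _.
by rewrite mulrDr mulr_sumr.
Qed.

Lemma worth_scale c p sg : worth (fun x => c * p x) sg = c * worth p sg.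
Proof. by rewrite /worth mulr_sumr; apply: eq_bigr => x _; rewrite mulrCA. Qed.

Lemma eq_worth p q sg : p =1 q -> worth p sg = worth q sg.
Proof. by move=> pq; apply: eq_bigr => x _; rewrite pq. Qed.

End Balances.

(** * Wallets, reserves, supplies, and executions with extra funds *)

Section States.
Variables (R : realType) (U T0 : choiceType).
Implicit Types (H : state R U T0) (A B : U) (t : T0 * T0) (T : tx R U T0)
  (sg : balance R T0) (r : R * R) (lam : seq (tx R U T0)).

Definition tx_pair T : T0 * T0 :=
  match T with Dep _ t _ => t | Swap _ _ t _ => t | Rdm _ t _ => t end.

(** Unlike [set_wallet], it adds to what the user already has, so that funds needed only later can
    be handed out at the start. *)
Definition add_wallet H A sg : state R U T0 := set_wallet H A (badd (bal H A) sg).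

Lemma bal_set H A B sg am :
  bal (State (wallets H).[A <- sg] am) B = if B == A then sg else bal H B.
Proof. by rewrite /bal fnd_set; case: eqP. Qed.

Lemma reserves_set w (am : {fmap T0 * T0 -> R * R}) t t' r :
  reserves (State w am.[t <- r] : state R U T0) t' =
  if t' == t then r else odflt (0, 0) am.[? t'].
Proof. by rewrite /reserves fnd_set; case: eqP. Qed.

Lemma reserves_notin H t : t \notin domf (amms H) -> reserves H t = (0, 0).
Proof. by rewrite /reserves => /not_fnd ->. Qed.

Lemma reservesE H t r : (amms H).[? t] = Some r -> reserves H t = r.
Proof. by rewrite /reserves => ->. Qed.

Lemma fnd_reserves H t : t \in domf (amms H) -> (amms H).[? t] = Some (reserves H t).
Proof. by rewrite /reserves; case: fndP. Qed.

Lemma fnd_dom H t r : (amms H).[? t] = Some r -> t \in domf (amms H).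
Proof. by case: fndP. Qed.

Lemma bal_notin H A : A \notin domf (wallets H) -> bal H A = bzero.
Proof. by rewrite /bal => /not_fnd ->. Qed.

Lemma sply_inr H t :
  sply H (inr t) = \sum_(A <- domf (wallets H)) bal H A (inr t).
Proof.
rewrite /sply [X in _ + X]big1 ?addr0// => t' _.
by rewrite !mul0r addr0.
Qed.

Lemma sply_sup H t (D : {fset U}) : (domf (wallets H) `<=` D)%fset ->
  sply H (inr t) = \sum_(A <- D) bal H A (inr t).
Proof.
move=> sD; rewrite sply_inr; apply: big_fset_incl => // A _ /bal_notin ->.
exact: bzeroE.
Qed.

Lemma sply_set H A sg am t :
  sply (State (wallets H).[A <- sg] am) (inr t) =
  sply H (inr t) + (sg (inr t) - bal H A (inr t)).
Proof.
set D := (A |` domf (wallets H))%fset.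
rewrite (@sply_sup _ _ D) ?dom_setf// (@sply_sup H _ D) ?fsubsetU1//.
have AD : A \in D by rewrite fset1U1.
rewrite (big_fsetD1 _ AD) [X in _ = X + _](big_fsetD1 _ AD)/= bal_set eqxx.
rewrite (eq_big_seq (fun B => bal H B (inr t))); first by ring.
by move=> B; rewrite 2!inE bal_set => /andP[/negPf ->].
Qed.

Lemma bal_add_wallet H A B sg :
  bal (add_wallet H A sg) B = if B == A then badd (bal H A) sg else bal H B.
Proof. exact: bal_set. Qed.

Lemma sply_add_wallet H A sg t : atomic_balance sg ->
  sply (add_wallet H A sg) (inr t) = sply H (inr t).
Proof. by case=> _ s0; rewrite sply_set baddE s0; ring. Qed.

Lemma add_walletA H A sg sg' :
  add_wallet (add_wallet H A sg) A sg' = add_wallet H A (badd sg sg').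
Proof.
rewrite {1}/add_wallet bal_add_wallet eqxx baddA /add_wallet /set_wallet/=.
by rewrite setfC eqxx.
Qed.

Lemma add_wallet_fresh H A sg : A \notin domf (wallets H) ->
  add_wallet H A sg = set_wallet H A sg.
Proof. by move=> AH; rewrite /add_wallet bal_notin// add0b. Qed.

Lemma add_wallet_set H A sg sg' :
  add_wallet (set_wallet H A sg) A sg' = set_wallet H A (badd sg sg').
Proof. by rewrite /add_wallet bal_set eqxx /set_wallet/= setfC eqxx. Qed.

Lemma update_add_wallet H A B b sg t r :
  update (add_wallet H A sg) B (if B == A then badd b sg else b) t r =
  omap (fun K => add_wallet K A sg) (update H B b t r).
Proof.
rewrite /update; case: ifP => //= _; congr Some.
rewrite /add_wallet bal_set /set_wallet/=; congr State.
have [->|BA] := eqVneq B A; first by rewrite setfC eqxx [RHS]setfC eqxx.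
by rewrite setfC (negPf BA).
Qed.

(** Atomic tokens in a wallet change neither reserves nor minted supplies, and an effect adds to
    balances amounts fixed by these and the transaction. *)
Lemma effect_add_wallet H A sg T : atomic_balance sg ->
  effect (add_wallet H A sg) T =
  omap (fun K => add_wallet K A sg) (effect H T).
Proof.
move=> sg0.
have E B b t r b' : b' = (if B == A then badd b sg else b) ->
    update (add_wallet H A sg) B b' t r =
    omap (fun K => add_wallet K A sg) (update H B b t r).
  by move=> ->; exact: update_add_wallet.
case: T => [B t v|B d t v|B t v] /=; rewrite ?sply_add_wallet// bal_add_wallet.
- case: ifP => // _; case: fndP => [tH|_].
    case: ifP => // _; apply: E; case: eqP => // ->.
    by rewrite -!credit_badd.
  case: ifP => // _; apply: E; case: eqP => // ->.
  by rewrite -!credit_badd.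
- case: fndP => // tH; case: ifP => // _; apply: E; case: eqP => // ->.
  by rewrite -!credit_badd.
- case: fndP => // tH; case: ifP => // _; apply: E; case: eqP => // ->.
  by rewrite -!credit_badd.
Qed.

Lemma funded_add_wallet H A sg T : atomic_balance sg ->
  funded H T -> funded (add_wallet H A sg) T.
Proof.
case=> sg0 _.
have E B x v : v <= bal H B x -> v <= bal (add_wallet H A sg) B x.
  move=> vle; rewrite bal_add_wallet; case: eqP vle => // -> vle.
  by rewrite baddE (le_trans vle)// lerDl.
case: T => [B t v|B d t v|B t v] /=; try exact: E.
by move=> /andP[? ?]; rewrite !E.
Qed.

Lemma stepE H H' T : step H T = Some H' -> effect H T = Some H'.
Proof. by rewrite /step; case: ifP. Qed.

Lemma step_add_wallet H H' A sg T : atomic_balance sg -> step H T = Some H' ->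
  step (add_wallet H A sg) T = Some (add_wallet H' A sg).
Proof.
move=> sg0; rewrite /step; case: ifP => // f E.
by rewrite funded_add_wallet// effect_add_wallet// E.
Qed.

Lemma run_cons H T lam : run H (T :: lam) = obind (fun K => run K lam) (step H T).
Proof.
rewrite /run /=; case: (step H T) => //=.
by elim: lam => //= ? ? ->.
Qed.

Lemma run_cat H lam1 lam2 :
  run H (lam1 ++ lam2) = obind (fun K => run K lam2) (run H lam1).
Proof.
elim: lam1 H => //= T lam1 IH H.
by rewrite !run_cons; case: (step H T) => //= K; rewrite IH.
Qed.

Lemma run_add_wallet H H' A sg lam : atomic_balance sg -> run H lam = Some H' ->
  run (add_wallet H A sg) lam = Some (add_wallet H' A sg).
Proof.
move=> sg0; elim: lam H => [H [->]//|T lam IH H].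
rewrite !run_cons; case E: (step H T) => [K|]//= rK.
by rewrite (step_add_wallet _ _ E)//= IH.
Qed.

Lemma run_add_cat H H1 H2 A sg1 sg2 lam1 lam2 :
  atomic_balance sg2 ->
  run (add_wallet H A sg1) lam1 = Some H1 ->
  run (add_wallet H1 A sg2) lam2 = Some H2 ->
  run (add_wallet H A (badd sg1 sg2)) (lam1 ++ lam2) = Some H2.
Proof.
move=> sg0 r1 r2; rewrite run_cat -add_walletA.
by rewrite (run_add_wallet _ sg0 r1).
Qed.

End States.

(** * The AM-GM slack of reserves, and what every transaction preserves *)

Section Potential.
Variables (R : realType) (U T0 : choiceType) (P : T0 -> R).
Hypothesis P_ge0 : forall a, 0 <= P a.
Implicit Types (H : state R U T0) (A B : U) (t : T0 * T0) (T : tx R U T0)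
  (sg : balance R T0) (r v : R * R) (lam : seq (tx R U T0)).

Definition atomic_price (x : token T0) : R := if x is inl a then P a else 0.

Definition value t r : R := r.1 * P t.1 + r.2 * P t.2.

(** The least value of reserves with product [r.1 * r.2] (AM-GM). *)
Definition floor_value t r : R := 2 * Num.sqrt (r.1 * r.2 * (P t.1 * P t.2)).

Definition slack t r : R := value t r - floor_value t r.

Lemma slack_ge0 t r : 0 <= r.1 -> 0 <= r.2 -> 0 <= slack t r.
Proof.
move=> r1 r2; rewrite subr_ge0 /floor_value /value.
have x0 : 0 <= r.1 * P t.1 by rewrite mulr_ge0.
have y0 : 0 <= r.2 * P t.2 by rewrite mulr_ge0.
have s0 := addr_ge0 x0 y0.
(* Both sides become square roots; the difference of the radicands is a perfect square. *)
rewrite -[leRHS](ger0_norm s0) -sqrtr_sqr.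
have -> : 2 = Num.sqrt (2 ^+ 2) :> R by rewrite sqrtr_sqr ger0_norm.
rewrite -sqrtrM ?sqr_ge0// ler_sqrt ?sqr_ge0// -subr_ge0.
have -> : (r.1 * P t.1 + r.2 * P t.2) ^+ 2 -
   2 ^+ 2 * (r.1 * r.2 * (P t.1 * P t.2)) =
   (r.1 * P t.1 - r.2 * P t.2) ^+ 2 by ring.
exact: sqr_ge0.
Qed.

(** Deposits and redeems scale both reserves by one factor, so homogeneity gives their effect on the
    slack. *)
Lemma slackZ q t r : 0 <= q -> slack t (q * r.1, q * r.2) = q * slack t r.
Proof.
move=> q0; rewrite /slack /value /floor_value/= mulrBr; congr (_ - _); first by ring.
have -> : q * r.1 * (q * r.2) * (P t.1 * P t.2) =
   q ^+ 2 * (r.1 * r.2 * (P t.1 * P t.2)) by ring.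
by rewrite sqrtrM ?sqr_ge0// sqrtr_sqr ger0_norm// mulrCA.
Qed.

Lemma floorZ q t r : 0 <= q -> floor_value t (q * r.1, q * r.2) = q * floor_value t r.
Proof.
move=> q0; have := slackZ t r q0; rewrite /slack /value/=.
by move=> h; rewrite -[LHS](subKr (q * r.1 * P t.1 + q * r.2 * P t.2)) h; ring.
Qed.

Lemma eq_floor t r r' : r.1 * r.2 = r'.1 * r'.2 -> floor_value t r = floor_value t r'.
Proof. by rewrite /floor_value => ->. Qed.

Lemma floor00 t : floor_value t (0, 0) = 0.
Proof. by rewrite /floor_value !mul0r sqrtr0 mulr0. Qed.

Lemma value00 t : value t (0, 0) = 0.
Proof. by rewrite /value !mul0r addr0. Qed.

(** The invariant of reachable states. Positive supplies allow counting per minted token, and the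
    last field makes a new AMM start from supply [0]. *)
Record sound H : Prop := Sound {
  sound_bal : forall A x, 0 <= bal H A x;
  sound_amm : forall t r, (amms H).[? t] = Some r ->
    [/\ 0 < r.1, 0 < r.2, t.1 != t.2, 0 < sply H (inr t) &
        (t.2, t.1) \notin domf (amms H)];
  sound_none : forall t A, t \notin domf (amms H) -> bal H A (inr t) = 0 }.

Lemma sound_sply0 H t : sound H -> t \notin domf (amms H) -> sply H (inr t) = 0.
Proof. by move=> sH tH; rewrite sply_inr big1// => A _; apply: sound_none. Qed.

(** What all transactions have in common: [A] pays what the AMM [t] gains, and
    the floor value of one minted token does not change. *)
Inductive exchange H A t H' : Prop := Exchange sg r of
  H' = State (wallets H).[A <- sg] (amms H).[t <- r] & 0 < r.1 & 0 < r.2 &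
  (forall t', t' != t -> sg (inr t') = bal H A (inr t')) &
  worth atomic_price sg + value t r =
    worth atomic_price (bal H A) + value t (reserves H t) &
  floor_value t r * sply H (inr t) = floor_value t (reserves H t) * sply H' (inr t) &
  0 < sply H' (inr t) & t.1 != t.2 & (t.2, t.1) \notin domf (amms H).

Lemma updateP H A sg t r H' : update H A sg t r = Some H' ->
  [/\ 0 < r.1, 0 < r.2 & H' = State (wallets H).[A <- sg] (amms H).[t <- r]].
Proof. by rewrite /update; case: ifP => // /andP[? ?] [<-]. Qed.

Lemma swap_floor (d : bool) t r x : 0 < side d r + x ->
  floor_value t (on_side d (side d r + x)
    (side (~~ d) r - side (~~ d) r * x / (side d r + x))) = floor_value t r.
Proof. by move=> h; apply: eq_floor; case: d h => /= h; field; rewrite gt_eqF. Qed.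

Lemma swap_value (d : bool) t (x y : R) :
  value t (on_side d x y) = x * P (side d t) + y * P (side (~~ d) t).
Proof. by case: d; rewrite /value//= addrC. Qed.

Lemma value_side (d : bool) t r :
  value t r = side d r * P (side d t) + side (~~ d) r * P (side (~~ d) t).
Proof. by case: d; rewrite /value//= addrC. Qed.

Lemma side_on_side (d : bool) (x y : R) : side d (on_side d x y) = x.
Proof. by case: d. Qed.

Lemma side_on_sideN (d : bool) (x y : R) : side (~~ d) (on_side d x y) = y.
Proof. by case: d. Qed.

Lemma side_gt0 (d : bool) r : 0 < r.1 -> 0 < r.2 -> 0 < side d r.
Proof. by case: d. Qed.

(** [c] is the amount of the minted token of [t] that [A] receives: positive for a deposit, negative
    for a redeem, zero for a swap. *)
Lemma exchangeI H A t sg r c H' :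
  update H A sg t r = Some H' ->
  (forall t', sg (inr t') = bal H A (inr t') + (if t' == t then c else 0)) ->
  worth atomic_price sg + value t r =
    worth atomic_price (bal H A) + value t (reserves H t) ->
  floor_value t r * sply H (inr t) =
    floor_value t (reserves H t) * (sply H (inr t) + c) ->
  0 < sply H (inr t) + c -> t.1 != t.2 -> (t.2, t.1) \notin domf (amms H) ->
  exchange H A t H'.
Proof.
move=> /updateP[r1 r2 E] h1 h2 h3 h4 h5 h6.
have sE : sply H' (inr t) = sply H (inr t) + c.
  by rewrite E sply_set h1 eqxx; ring.
apply: (Exchange E) => //; rewrite ?sE//.
by move=> t' /negPf t't; rewrite h1 t't addr0.
Qed.

Lemma effect_exchange H H' T : sound H -> effect H T = Some H' ->
  exchange H (owner T) (tx_pair T) H'.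
Proof.
move=> sH; case: T => [A t v|A d t v|A t v] /=.
- case: ifP => // /andP[v1 v2]; case E: (_.[? t]) => [r|].
    have [r1 r2 t12 s0 tN] := sound_amm sH E.
    case: ifP => // /eqP e; set s := sply H _ => up.
    (* The premise says that [v] is proportional to [r], so the deposit scales reserves and supply
       by [1 + v.1 / r.1]. *)
    have v2E : v.2 = v.1 / r.1 * r.2.
      by apply: (mulfI (lt0r_neq0 r1)); rewrite -e; field; rewrite gt_eqF.
    have q0 : 0 < v.1 / r.1 by rewrite divr_gt0.
    apply: (exchangeI (c := v.1 / r.1 * s) up) => //.
    + by move=> t'; rewrite !creditE !addr0.
    + by rewrite !worth_credit (reservesE E) /value/=; ring.
    + rewrite (reservesE E) -/s.
      have -> : (r.1 + v.1, r.2 + v.2) =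
          ((1 + v.1 / r.1) * r.1, (1 + v.1 / r.1) * r.2).
        by rewrite v2E; congr pair; field; rewrite gt_eqF.
      by rewrite floorZ ?addr_ge0 ?ltW//; ring.
    + by rewrite -/s addr_gt0// mulr_gt0.
  (* A new AMM: the old reserves default to [(0, 0)] and the old supply is [0], so both sides of the
     floor identity vanish. *)
  have tH : t \notin domf (amms H) by case: fndP E.
  case: ifP => // /andP[t12 tN] up.
  apply: (exchangeI (c := v.1) up) => //.
  + by move=> t'; rewrite !creditE !addr0.
  + by rewrite !worth_credit (reserves_notin tH) /value/=; ring.
  + by rewrite (reserves_notin tH) floor00 sound_sply0//; ring.
  + by rewrite sound_sply0// add0r.
- case E: (_.[? t]) => [r|]//; case: ifP => // /and3P[vd vd' _] up.
  have [r1 r2 t12 s0 tN] := sound_amm sH E.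
  have rd := side_gt0 d r1 r2.
  apply: (exchangeI (c := 0) up) => //.
  + by move=> t'; rewrite !creditE !addr0 if_same addr0.
  + by rewrite !worth_credit swap_value (reservesE E) (value_side d)/=; ring.
  + by rewrite addr0 swap_floor ?addr_gt0// (reservesE E).
  + by rewrite addr0.
- case E: (_.[? t]) => [r|]//; case: ifP => // v0.
  have [r1 r2 t12 s0 tN] := sound_amm sH E.
  set s := sply H _ in s0 * => up.
  have qE : (r.1 - v * r.1 / s, r.2 - v * r.2 / s) =
      ((1 - v / s) * r.1, (1 - v / s) * r.2).
    by congr pair; field; rewrite gt_eqF.
  (* [update] demands positive reserves, which prevents redeeming the whole supply. *)
  have q0 : 0 < 1 - v / s.
    by case/updateP: (up); rewrite qE/= (pmulr_lgt0 _ r1).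
  apply: (exchangeI (c := - v) up) => //.
  + by move=> t'; rewrite !creditE !addr0.
  + by rewrite !worth_credit (reservesE E) /value/=; ring.
  + by rewrite qE (reservesE E) -/s floorZ ?ltW//; field; rewrite gt_eqF.
  + by move: q0; rewrite -/s !subr_gt0 ltr_pdivrMr// mul1r.
Qed.

End Potential.

(** * Preservation of the invariant *)

Section Soundness.
Variables (R : realType) (U T0 : choiceType).
Implicit Types (H : state R U T0) (A : U) (T : tx R U T0) (sg : balance R T0)
  (lam : seq (tx R U T0)).

Lemma sound_step H H' T : sound H -> step H T = Some H' -> sound H'.
Proof.
move=> sH sT.
(* Soundness does not mention prices, so the exchange is taken at price zero. It settles everything
   but the sign of the owner's balance. *)
have [sg r E r1 r2 sgN _ _ s'0 t12 tN] :=
  effect_exchange (fun=> 0) sH (stepE sT).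
have sg0 x : 0 <= sg x.
  have -> : sg x = bal H' (owner T) x by rewrite E bal_set eqxx.
  move: sT; rewrite /step; case: ifP => //.
  have b0 := sound_bal sH (owner T).
  case: {E sgN s'0 tN} T t12 b0 => [A t v|A d t v|A t v] /= t12 b0 f.
  - case: ifP => // /andP[v1 v2].
    have c0 c y : 0 <= c -> 0 <= credit (credit (credit (bal H A)
        (inl t.1) (- v.1)) (inl t.2) (- v.2)) (inr t) c y.
      move=> c0; rewrite !creditE; case/andP: f => f1 f2.
      case: (y =P inl t.1) => [->|_].
        rewrite !(inj_eq (@inl_inj _ _)) (negPf t12).
        by rewrite !addr0 subr_ge0.
      case: (y =P inl t.2) => [->|_]; first by rewrite !addr0 subr_ge0.
      by rewrite !addr0 addr_ge0//; case: ifP.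
    case E: (_.[? t]) => [r'|].
      have [r1' _ _ s0 _] := sound_amm sH E.
      case: ifP => // _ /updateP[_ _ ->]; rewrite bal_set eqxx c0// mulr_ge0 ?ltW//.
      by rewrite divr_gt0.
    by case: ifP => // _ /updateP[_ _ ->]; rewrite bal_set eqxx c0// ltW.
  - case E: (_.[? t]) => [r'|]//; case: ifP => // /and3P[v1 v2 w0].
    move=> /updateP[_ _ ->]; rewrite bal_set eqxx !creditE.
    rewrite addr_ge0//; last by case: ifP => // _; apply: le_trans w0; rewrite ltW.
    by case: (x =P _) => [->|_]; rewrite ?subr_ge0 ?addr0.
  - case E: (_.[? t]) => [r'|]//; case: ifP => // v0.
    have [r1' r2' _ s0 _] := sound_amm sH E.
    move=> /updateP[_ _ ->]; rewrite bal_set eqxx !creditE.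
    have w0 y : 0 < y -> 0 <= v * y / sply H (inr t).
      by move=> y0; rewrite divr_ge0 ?mulr_ge0 ?ltW.
    rewrite addr_ge0//; last by case: ifP => // _; apply: w0.
    rewrite addr_ge0//; last by case: ifP => // _; apply: w0.
    by case: (x =P _) => [->|_]; rewrite ?subr_ge0 ?addr0.
have domE t : (t \in domf (amms H')) = (t == tx_pair T) || (t \in domf (amms H)).
  by rewrite E mem_setf inE.
have fndE t : (amms H').[? t] = if t == tx_pair T then Some r else (amms H).[? t].
  by rewrite E fnd_set.
split.
- by move=> A x; rewrite E bal_set; case: eqP => // _; apply: (sound_bal sH).
- move=> t r'; rewrite domE fndE; case: eqP => [-> [<-]|/eqP tT tr].
    split=> //; rewrite negb_or tN andbT; apply: contra t12.
    by case: (tx_pair T) => a b /= /eqP[->].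
  have [? ? ? s0 tN'] := sound_amm sH tr; split => //.
    by rewrite E sply_set (sgN _ tT) subrr addr0.
  rewrite negb_or tN' andbT; apply: contra tN => /eqP <- /=.
  by rewrite -surjective_pairing (fnd_dom tr).
- move=> t A; rewrite domE negb_or => /andP[tT tH].
  by rewrite E bal_set; case: eqP => _; rewrite ?(sgN _ tT); apply: sound_none.
Qed.

Lemma sound_run H H' lam : sound H -> run H lam = Some H' -> sound H'.
Proof.
elim: lam H => [H sH [<-]//|T lam IH H sH].
by rewrite run_cons; case E: (step H T) => [K|]//=; apply: IH (sound_step sH E).
Qed.

Lemma sound_initial H : initial H -> sound H.
Proof.
case=> aH bH; split.
- by move=> A; case: (bH A).
- by move=> t r; rewrite aH fnd_fmap0.
- by move=> t A _; case: (bH A).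
Qed.

Lemma sound_reachable H : reachable H -> sound H.
Proof. by case=> H0 [lam [/sound_initial s0]]; apply: sound_run. Qed.

Lemma sound_add_wallet H A sg : atomic_balance sg -> sound H ->
  sound (add_wallet H A sg).
Proof.
move=> sg0 sH; split.
- move=> B x; rewrite bal_add_wallet; case: eqP => _; last exact: (sound_bal sH).
  by rewrite baddE addr_ge0 ?(sound_bal sH)//; case: sg0.
- by move=> t r /(sound_amm sH); rewrite sply_add_wallet.
- move=> t B tH; rewrite bal_add_wallet; case: eqP => _; last exact: (sound_none sH).
  by rewrite baddE (sound_none sH)//; case: sg0 => _ ->; rewrite addr0.
Qed.

End Soundness.

(** * The adversary's potential under one transaction *)

Section Adversary.
Variables (R : realType) (U T0 : choiceType) (P : T0 -> R) (M : U).
Hypothesis P_ge0 : forall a, 0 <= P a.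
Implicit Types (H : state R U T0) (A B : U) (t : T0 * T0) (T : tx R U T0)
  (sg : balance R T0) (r v : R * R) (lam : seq (tx R U T0)).

Local Notation atomic_price := (atomic_price P).
Local Notation value := (value P).
Local Notation floor_value := (floor_value P).
Local Notation slack := (slack P).

(** Everyone but the adversary counts as a user; with supply [0] the quotient is [0]. *)
Definition users_share H t : R :=
  (sply H (inr t) - bal H M (inr t)) / sply H (inr t).

(** The part of the reserves that users cannot claim in the worst case. *)
Definition claim H t : R :=
  value t (reserves H t) - users_share H t * floor_value t (reserves H t).

Definition potential H : R :=
  worth atomic_price (bal H M) + \sum_(t <- domf (amms H)) claim H t.

(** The largest amount by which [T], fired by a user, can raise the potential. *)
Definition tx_gain T : R :=
  match T with
  | Dep _ t v => slack t v
  | Swap _ a t v => Num.max 0 (- swap_profit P a t v)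
  | Rdm _ _ _ => 0
  end.

(** Writing prices as a combination of indicators lets the net worth split by linearity into atomic
    tokens and one term per AMM. *)
Lemma priceE H x : price P H x = atomic_price x +
  \sum_(t <- domf (amms H))
    value t (reserves H t) / sply H (inr t) * ((inr t : token T0) == x)%:R.
Proof.
case: x => [a|t] /=; first by rewrite big1 ?addr0// => t _; rewrite mulr0.
rewrite add0r; case E: (_.[? t]) => [r|].
  rewrite (big_fsetD1 t) ?(fnd_dom E)//= eqxx mulr1 (reservesE E).
  rewrite big_seq_cond big1 ?addr0// => t'; rewrite !inE andbT => /andP[/negPf t't _].
  by rewrite (inj_eq (@inr_inj _ _)) t't mulr0.
rewrite big_seq_cond big1// => t'; rewrite andbT => t'H.
rewrite (inj_eq (@inr_inj _ _)); case: eqP => [tt'|]; last by rewrite mulr0.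
by move: t'H; rewrite tt'; case: fndP E.
Qed.

Lemma net_worthE H : net_worth P M H = worth atomic_price (bal H M) +
  \sum_(t <- domf (amms H))
    value t (reserves H t) / sply H (inr t) * bal H M (inr t).
Proof.
rewrite /net_worth -/(worth (price P H) (bal H M)) (eq_worth _ (priceE H)).
rewrite worth_sum; congr (_ + _); apply: eq_bigr => t _.
by rewrite worth_scale worth_eq.
Qed.

(** Hence the net worth is at most the potential, and equals it once every slack is zero. *)
Lemma potentialE H : sound H -> potential H = net_worth P M H +
  \sum_(t <- domf (amms H)) users_share H t * slack t (reserves H t).
Proof.
move=> sH; rewrite net_worthE /potential -addrA -big_split/=; congr (_ + _).
apply: eq_big_seq => t /fnd_reserves /(sound_amm sH)[_ _ _ s0 _].
by rewrite /claim /users_share /slack; field; rewrite gt_eqF.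
Qed.

Lemma users_share_ge0 H t : sound H -> 0 <= users_share H t <= 1.
Proof.
move=> sH; have s0 : 0 <= bal H M (inr t) <= sply H (inr t).
  rewrite (sound_bal sH)/=.
  rewrite (@sply_sup _ _ _ _ _ (M |` domf (wallets H))%fset) ?fsubsetU1//.
  rewrite (big_fsetD1 M) ?fset1U1//= lerDl sumr_ge0// => A _.
  exact: (sound_bal sH).
have [s00|s1] := eqVneq (sply H (inr t)) 0.
  by rewrite /users_share s00 invr0 mulr0 lexx ler01.
have sp : 0 < sply H (inr t).
  by rewrite lt_def s1; case/andP: s0 => ? ?; apply: (le_trans (y := bal H M (inr t))).
case/andP: s0 => b0 bs; rewrite /users_share ler_pdivrMr// mul1r gerBl b0 andbT.
by rewrite divr_ge0 ?subr_ge0// ltW.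
Qed.

Lemma claim_notin H t : t \notin domf (amms H) -> claim H t = 0.
Proof.
move=> tH; rewrite /claim (reserves_notin tH) value00 floor00 mulr0.
exact: subr0.
Qed.

Lemma claim_add_wallet H sg t : atomic_balance sg ->
  claim (add_wallet H M sg) t = claim H t.
Proof.
move=> sg0; rewrite /claim /users_share sply_add_wallet// bal_add_wallet eqxx.
by rewrite baddE; case: sg0 => _ ->; rewrite addr0.
Qed.

Lemma potential_add_wallet H sg : atomic_balance sg ->
  potential (add_wallet H M sg) = potential H + worth atomic_price sg.
Proof.
move=> sg0; rewrite /potential bal_add_wallet eqxx worth_badd addrAC.
by congr (_ + _ + _); apply: eq_bigr => t _; rewrite claim_add_wallet.
Qed.

Lemma net_worth_add_wallet H sg : atomic_balance sg ->
  net_worth P M (add_wallet H M sg) = net_worth P M H + worth atomic_price sg.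
Proof.
move=> sg0; rewrite !net_worthE bal_add_wallet eqxx worth_badd addrAC.
congr (_ + _ + _); apply: eq_bigr => t _; rewrite sply_add_wallet// baddE.
by case: sg0 => _ ->; rewrite addr0.
Qed.

(** If the adversary moves, atomic worth plus reserve value is conserved, and so is the users' floor
    claim: the number of their minted tokens and the floor per token stay fixed. If a user moves,
    the adversary's balance and the floor value of its minted tokens stay fixed, so the potential
    changes as the value minus the floor of the reserves does. *)
Lemma potential_exchange H H' A t : sound H -> exchange P H A t H' ->
  potential H' = potential H +
    (if A == M then 0 else slack t (reserves H' t) - slack t (reserves H t)).
Proof.
move=> sH [sg r E r1 r2 sgN wE fE s'0 _ _].
have rE t' : reserves H' t' = if t' == t then r else reserves H t'.
  by rewrite E reserves_set.
have bE B : bal H' B = if B == A then sg else bal H B by rewrite E bal_set.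
have sE t' : sply H' (inr t') = sply H (inr t') + (sg (inr t') - bal H A (inr t')).
  by rewrite E sply_set.
have dE : domf (amms H') = (t |` domf (amms H))%fset by rewrite E dom_setf.
rewrite /potential dE.
(* A missing AMM has claim [0], so the old sum may range over [t] too. *)
rewrite [X in _ = _ + X + _](@big_fset_incl _ _ _ _ _ (t |` domf (amms H))%fset).
- have tD : t \in (t |` domf (amms H))%fset by rewrite fset1U1.
  rewrite [in LHS](big_fsetD1 t tD) [in RHS](big_fsetD1 t tD)/=.
  rewrite (eq_big_seq (claim H)); last first.
    move=> t'; rewrite !inE => /andP[t't _].
    rewrite /claim /users_share rE (negPf t't) sE sgN// subrr addr0 bE.
    by case: eqP => // ->; rewrite sgN.
  set S := \sum_(_ <- _) _.
  suff : worth atomic_price (bal H' M) + claim H' t =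
      worth atomic_price (bal H M) + claim H t +
      (if A == M then 0 else slack t (reserves H' t) - slack t (reserves H t)).
    by move=> h; rewrite addrA h [in RHS]addrA; exact: addrAC.
  rewrite /claim /users_share !rE eqxx bE; move: fE s'0; rewrite sE.
  set s := sply H _; set f := floor_value t r; set f0 := floor_value t _.
  move=> fE s'0; rewrite [M == A]eq_sym.
  have [tH|tH] := boolP (t \in domf (amms H)).
    have [_ _ _ s0 _] := sound_amm sH (fnd_reserves tH); rewrite -/s in s0.
    have -> : f = f0 * (s + (sg (inr t) - bal H A (inr t))) / s.
      by rewrite -fE mulfK// gt_eqF.
    case: eqP => [AM|_]; rewrite /slack -/f -/f0.
      rewrite AM in wE s'0 *.
      have -> : worth atomic_price sg =
         worth atomic_price (bal H M) + value t (reserves H t) - value t r.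
         by rewrite -wE addrK.
      by field; rewrite !gt_eqF.
    have -> : f = f0 * (s + (sg (inr t) - bal H A (inr t))) / s.
      by rewrite -fE mulfK// gt_eqF.
    by field; rewrite !gt_eqF.
  (* For a new AMM the old supply [0] gives no floor per token; as nobody held its minted token
     before, the identity is checked directly. *)
  have b0 B : bal H B (inr t) = 0 by exact: sound_none.
  have z : s = 0 by exact: sound_sply0.
  have z0 : f0 = 0 by rewrite /f0 (reserves_notin tH) floor00.
  rewrite z !b0 z0 mulr0 !add0r !subr0 in s'0 *.
  case: eqP => [AM|_]; rewrite /slack -/f -/f0 ?z0.
    rewrite AM in wE.
    have -> : worth atomic_price sg =
       worth atomic_price (bal H M) + value t (reserves H t) - value t r.
       by rewrite -wE addrK.
    by rewrite subrr; ring.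
  by rewrite b0; field; rewrite gt_eqF.
- exact: fsubsetU1.
- by move=> t' _ /claim_notin.
Qed.

End Adversary.

(** * Bounds on the potential along moves, and swaps towards given reserves *)

Section Moves.
Variables (R : realType) (U T0 : choiceType) (P : T0 -> R) (M : U).
Hypothesis P_ge0 : forall a, 0 <= P a.
Implicit Types (H : state R U T0) (A B : U) (t : T0 * T0) (T : tx R U T0)
  (sg : balance R T0) (r v : R * R) (lam : seq (tx R U T0)).

Local Notation slack := (slack P).
Local Notation tx_gain := (tx_gain P).
Local Notation potential := (potential P M).
Local Notation user_txs := (user_txs M).

(** A condition on the amounts alone, implied by every execution; it lets the transactions of a
    competing move be reused in another state. *)
Definition valid_tx T : bool :=
  match T with
  | Dep _ _ v | Swap _ _ _ v => (0 < v.1) && (0 < v.2)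
  | Rdm _ _ _ => true
  end.

Lemma valid_side (d : bool) v :
  (0 < side d v) && (0 < side (~~ d) v) = (0 < v.1) && (0 < v.2).
Proof. by case: d => //=; rewrite andbC. Qed.

Lemma swap_effect H H' A d t v : effect H (Swap A d t v) = Some H' ->
  exists r, let w := side (~~ d) r * side d v / (side d r + side d v) in
  [/\ (amms H).[? t] = Some r, (0 < v.1) && (0 < v.2), side (~~ d) v <= w &
      amms H' = (amms H).[t <- on_side d (side d r + side d v) (side (~~ d) r - w)]].
Proof.
rewrite /=; case E: (_.[? t]) => [r|]//; case: ifP => // /and3P[v1 v2 w0].
by move=> /updateP[_ _ ->]; exists r; split=> //=; rewrite -(valid_side d) v1 v2.
Qed.

Lemma slack_swap H H' A d t v r : sound H -> (amms H).[? t] = Some r ->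
  effect H (Swap A d t v) = Some H' ->
  slack t (reserves H' t) - slack t (reserves H t) =
  side d v * P (side d t) -
  side (~~ d) r * side d v / (side d r + side d v) * P (side (~~ d) t).
Proof.
move=> sH tr /swap_effect[r' []]; rewrite tr => -[<-].
rewrite -(valid_side d) => /andP[v1 v2] _ E.
have [r1 r2 _ _ _] := sound_amm sH tr.
have rd := side_gt0 d r1 r2.
rewrite (reservesE tr) /reserves E fnd_set eqxx/= /slack.
by rewrite swap_floor ?addr_gt0// swap_value (value_side _ d); ring.
Qed.

(** The slack is additive on proportional pairs, so the increase does not depend on the reserves; a
    new AMM starts from slack [0]. *)
Lemma slack_dep H H' A t v : sound H -> effect H (Dep A t v) = Some H' ->
  slack t (reserves H' t) - slack t (reserves H t) = slack t v.
Proof.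
move=> sH /=; case: ifP => // /andP[v1 v2]; case tr: (_.[? t]) => [r|].
  have [r1 r2 _ _ _] := sound_amm sH tr.
  case: ifP => // /eqP e /updateP[_ _ ->].
  have q0 : 0 < v.1 / r.1 by rewrite divr_gt0.
  have v2E : v.2 = v.1 / r.1 * r.2.
    by apply: (mulfI (lt0r_neq0 r1)); rewrite -e; field; rewrite gt_eqF.
  have vE : v = (v.1 / r.1 * r.1, v.1 / r.1 * r.2).
    by rewrite -v2E divfK ?gt_eqF// -surjective_pairing.
  rewrite (reservesE tr) reserves_set eqxx [in RHS]vE slackZ ?ltW//.
  have -> : (r.1 + v.1, r.2 + v.2) =
      ((1 + v.1 / r.1) * r.1, (1 + v.1 / r.1) * r.2).
    by rewrite v2E; congr pair; field; rewrite gt_eqF.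
  by rewrite slackZ ?addr_ge0 ?ltW//; ring.
have tH : t \notin domf (amms H) by case: fndP tr.
case: ifP => // _ /updateP[_ _ ->]; rewrite reserves_set eqxx (reserves_notin tH).
by rewrite /slack value00 floor00 !subr0.
Qed.

(** A redeem shrinks both reserves by a common factor, hence the nonnegative slack too. *)
Lemma slack_rdm H H' A t x : sound H -> effect H (Rdm A t x) = Some H' ->
  slack t (reserves H' t) - slack t (reserves H t) <= 0.
Proof.
move=> sH /=; case tr: (_.[? t]) => [r|]//; case: ifP => // x0 up.
have [r1 r2 _ s0 _] := sound_amm sH tr; have [q1 _ ->] := updateP up.
move: q1; rewrite reserves_set eqxx (reservesE tr) /=; set s := sply H _ in s0 *.
have -> : (r.1 - x * r.1 / s, r.2 - x * r.2 / s) =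
    ((1 - x / s) * r.1, (1 - x / s) * r.2).
  by congr pair; field; rewrite gt_eqF.
have -> : r.1 - x * r.1 / s = (1 - x / s) * r.1 by field; rewrite gt_eqF.
rewrite pmulr_lgt0// => q0; rewrite slackZ ?(ltW q0)//.
have -> : (1 - x / s) * slack t r - slack t r = - (x / s * slack t r) by ring.
by rewrite oppr_le0 mulr_ge0 ?slack_ge0 ?divr_ge0// ltW.
Qed.

(** A swap gives the user at least the requested minimum, hence the bound by [- swap_profit];
    deposits meet theirs exactly. *)
Lemma tx_gain_ub H H' T : sound H -> effect H T = Some H' ->
  slack (tx_pair T) (reserves H' (tx_pair T)) -
    slack (tx_pair T) (reserves H (tx_pair T)) <= tx_gain T.
Proof.
move=> sH; case: T => [A t v|A d t v|A t v].
- by move/(slack_dep sH) => ->.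
- move=> E; have [r [tr v0 vw _]] := swap_effect E.
  rewrite (slack_swap sH tr E) /= /swap_profit le_max; apply/orP; right.
  have := ler_wpM2r (P_ge0 (side (~~ d) t)) vw; lra.
- exact: slack_rdm.
Qed.

Lemma tx_gain_ge0 T : valid_tx T -> 0 <= tx_gain T.
Proof.
case: T => [A t v|A d t v|A t v] //=; last by rewrite le_max lexx.
by case/andP=> ? ?; rewrite slack_ge0// ltW.
Qed.

Lemma potential_step H H' T : sound H -> step H T = Some H' ->
  potential H' = potential H +
    (if owner T == M then 0 else
     slack (tx_pair T) (reserves H' (tx_pair T)) -
     slack (tx_pair T) (reserves H (tx_pair T))).
Proof. by move=> sH /stepE/(effect_exchange P sH); apply: potential_exchange. Qed.

Lemma potential_run H H' lam : sound H -> run H lam = Some H' ->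
  potential H' <= potential H + \sum_(T <- user_txs lam) tx_gain T.
Proof.
elim: lam H => [H _ [<-]|T lam IH H sH]; first by rewrite big_nil addr0.
rewrite run_cons; case E: (step H T) => [K|]//= rK.
apply: le_trans (IH _ (sound_step sH E) rK) _.
rewrite (potential_step sH E) /user_txs /=; case: eqP => _ /=.
  by rewrite addr0.
by rewrite big_cons [leRHS]addrA lerD2r lerD2l tx_gain_ub// (stepE E).
Qed.

Lemma potential_run_adversary H H' lam : sound H -> user_txs lam = [::] ->
  run H lam = Some H' -> potential H' = potential H.
Proof.
elim: lam H => [H _ _ [<-]//|T lam IH H sH].
rewrite {1}/user_txs /= run_cons; case E: (step H T) => [K|]//=.
case: ifP => // oT u rK; rewrite (IH _ (sound_step sH E) u rK).
by rewrite (potential_step sH E) (negbFE oT) addr0.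
Qed.

Lemma step_amms H H' T : sound H -> step H T = Some H' ->
  domf (amms H') = (tx_pair T |` domf (amms H))%fset.
Proof.
by move=> sH /stepE/(effect_exchange (fun=> 0) sH)[sg r -> *]; rewrite dom_setf.
Qed.

Lemma effect_valid H H' T : effect H T = Some H' -> valid_tx T.
Proof.
case: T => [A t v|A d t v|A t v] //=; first by case: ifP.
by move=> /(@swap_effect H H' A)[r []].
Qed.

(** AMMs never disappear, so whatever was executed operates on an AMM of the last state. *)
Lemma run_amms H H' lam : sound H -> run H lam = Some H' ->
  (domf (amms H) `<=` domf (amms H'))%fset /\
  (forall T, T \in lam -> valid_tx T /\ tx_pair T \in domf (amms H')).
Proof.
elim: lam H => [H _ [<-]|T lam IH H sH]; first by split=> //; exact: fsubset_refl.
rewrite run_cons; case E: (step H T) => [K|]//= rK.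
have [KH' lamH'] := IH _ (sound_step sH E) rK.
rewrite (step_amms sH E) in KH'; split.
  by apply: fsubset_trans KH'; exact: fsubsetU1.
move=> T'; rewrite in_cons => /predU1P[->|]; last exact: lamH'.
split; first exact: effect_valid (stepE E).
by apply: (fsubsetP KH'); rewrite fset1U1.
Qed.

Lemma user_txs_cat lam1 lam2 : user_txs (lam1 ++ lam2) = user_txs lam1 ++ user_txs lam2.
Proof. exact: filter_cat. Qed.

Lemma front_amounts1 (m : bool) r rho :
  side m (front_amounts m r rho) = side m rho - side m r.
Proof. by case: m. Qed.

Lemma front_amounts2 (m : bool) r rho :
  side (~~ m) (front_amounts m r rho) = side (~~ m) r - side (~~ m) rho.
Proof. by case: m. Qed.

Lemma prod_side (m : bool) r : side m r * side (~~ m) r = r.1 * r.2.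
Proof. by case: m; rewrite // mulrC. Qed.

(** The constant product rule: a swap fed with the growth of one reserve lands exactly on [rho]. *)
Lemma front_out (m : bool) r rho : 0 < side m rho -> rho.1 * rho.2 = r.1 * r.2 ->
  side (~~ m) r * side m (front_amounts m r rho) /
    (side m r + side m (front_amounts m r rho)) = side (~~ m) r - side (~~ m) rho.
Proof.
rewrite -!(prod_side m) front_amounts1 subrKC => rho0 e.
apply: (mulIf (lt0r_neq0 rho0)); rewrite divfK ?gt_eqF// mulrBr mulrBl.
by rewrite [side (~~ m) rho * _]mulrC e [side m r * _]mulrC.
Qed.

Lemma front_effect H H' m t r rho : (amms H).[? t] = Some r ->
  rho.1 * rho.2 = r.1 * r.2 -> 0 < side m rho ->
  effect H (Swap M m t (front_amounts m r rho)) = Some H' ->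
  amms H' = (amms H).[t <- rho].
Proof.
move=> tr e rho0 /swap_effect[r' []]; rewrite tr => -[<-] _ _ ->.
rewrite front_out// front_amounts1 subrKC subKr.
by case: m {rho0} => /=; rewrite -surjective_pairing.
Qed.

Lemma front_run H m t r rho : sound H -> (amms H).[? t] = Some r ->
  rho.1 * rho.2 = r.1 * r.2 -> 0 < rho.1 -> 0 < rho.2 -> side m r < side m rho ->
  let u := front_amounts m r rho in
  exists2 H', run (add_wallet H M (bsingle (inl (side m t)) (side m u)))
                  [:: Swap M m t u] = Some H' & amms H' = (amms H).[t <- rho].
Proof.
move=> sH tr e rho1 rho2 lt_m u.
have [r1 r2 _ _ _] := sound_amm sH tr.
have rm := side_gt0 m r1 r2; have rhom := side_gt0 m rho1 rho2.
have rhom' := side_gt0 (~~ m) rho1 rho2.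
have um : 0 < side m u by rewrite front_amounts1 subr_gt0.
have um' : 0 < side (~~ m) u.
  rewrite front_amounts2 subr_gt0 -(ltr_pM2l rm) prod_side -e -(prod_side m).
  by rewrite ltr_pM2r.
set K := add_wallet _ _ _.
suff [H' E] : exists H', effect K (Swap M m t u) = Some H'.
  exists H'; last by rewrite (front_effect _ _ _ E).
  rewrite run_cons /step E /= bal_add_wallet eqxx baddE bsingleE eqxx.
  by rewrite lerDr (sound_bal sH).
rewrite /= tr um um' front_amounts2 front_out// lexx/=.
rewrite front_amounts1 subrKC subKr /update ifT; first by eexists.
by case: (m); rewrite /= rho1 rho2.
Qed.

(** At most one swap, with the funds for it, since with equal products at most one reserve grows. *)
Definition relocate t r rho : balance R T0 * seq (tx R U T0) :=
  let front m := (bsingle (inl (side m t)) (side m (front_amounts m r rho)),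
                  [:: Swap M m t (front_amounts m r rho)]) in
  if r.1 < rho.1 then front false
  else if r.2 < rho.2 then front true else (bzero, [::]).

Lemma relocateP H t r rho : sound H -> (amms H).[? t] = Some r ->
  rho.1 * rho.2 = r.1 * r.2 -> 0 < rho.1 -> 0 < rho.2 ->
  [/\ atomic_balance (relocate t r rho).1, user_txs (relocate t r rho).2 = [::] &
   exists2 H', run (add_wallet H M (relocate t r rho).1) (relocate t r rho).2 = Some H' &
     forall t', (amms H').[? t'] = if t' == t then Some rho else (amms H).[? t']].
Proof.
move=> sH tr e rho1 rho2; have [r1 r2 _ _ _] := sound_amm sH tr.
rewrite /relocate; case: ltP => [lt1|le1].
  split=> /=; first by apply: atomic_bsingle; rewrite subr_ge0 ltW.
    by rewrite /user_txs /= eqxx.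
  have [H' rH aH] := @front_run H false t r rho sH tr e rho1 rho2 lt1.
  by exists H' => // t'; rewrite aH fnd_set.
case: ltP => [lt2|le2].
  split=> /=; first by apply: atomic_bsingle; rewrite subr_ge0 ltW.
    by rewrite /user_txs /= eqxx.
  have [H' rH aH] := @front_run H true t r rho sH tr e rho1 rho2 lt2.
  by exists H' => // t'; rewrite aH fnd_set.
split=> //=; first exact: atomic_bzero.
exists (add_wallet H M bzero) => //= t'; case: eqP => [->|//]; rewrite tr; congr Some.
(* No reserve grows and the products agree, so [rho] is already [r]. *)
have e1 : r.1 = rho.1.
  apply/eqP; rewrite eq_le le1 andbT -(ler_pM2r r2) -e ler_pM2l//.
apply: injective_projections => //; apply: (mulfI (lt0r_neq0 r1)).
by rewrite -e e1.
Qed.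

End Moves.

(** * Inner layers: exact gain and existence *)

Section InnerLayer.
Variables (R : realType) (U T0 : choiceType) (P : T0 -> R) (M : U).
Hypothesis P_ge0 : forall a, 0 <= P a.
Implicit Types (H : state R U T0) (A B : U) (t : T0 * T0) (T : tx R U T0)
  (sg : balance R T0) (r v : R * R) (lam : seq (tx R U T0)).

Local Notation slack := (slack P).
Local Notation tx_gain := (tx_gain P).
Local Notation potential := (potential P M).
Local Notation user_txs := (user_txs M).

(** [rho] is the point of the constant product curve where the swap returns exactly its minimum; its
    component [x] on side [a] is the positive root of the equation [quad]. *)
Lemma swap_reservesP a v r (rho := swap_reserves a v r) :
  0 < v.1 -> 0 < v.2 -> 0 < r.1 -> 0 < r.2 ->
  [/\ 0 < rho.1, 0 < rho.2, rho.1 * rho.2 = r.1 * r.2 &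
      side (~~ a) rho * side a v / (side a rho + side a v) = side (~~ a) v].
Proof.
move=> v1 v2 r1 r2.
have k0 : 0 < r.1 * r.2 by rewrite mulr_gt0.
have p0 : 0 < v.1 * v.2 by rewrite mulr_gt0.
have va := side_gt0 a v1 v2; have vb := side_gt0 (~~ a) v1 v2.
set s := Num.sqrt (v.1 ^+ 2 * v.2 ^+ 2 + 4 * v.1 * v.2 * r.1 * r.2).
have s2 : s ^+ 2 = (v.1 * v.2) ^+ 2 + 4 * (v.1 * v.2) * (r.1 * r.2).
  rewrite sqr_sqrtr; first by ring.
  by rewrite addr_ge0 ?mulr_ge0 ?sqr_ge0// ltW.
have sp : v.1 * v.2 < s.
  rewrite -(@ltr_pXn2r _ 2)// ?nnegrE ?sqrtr_ge0 ?ltW// s2 ltrDl.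
  by rewrite mulr_gt0// mulr_gt0.
set x := (s - v.1 * v.2) / (2 * side (~~ a) v).
have x0 : 0 < x by rewrite divr_gt0 ?mulr_gt0// subr_gt0.
have rhoE : rho = on_side a x (r.1 * r.2 / x) by [].
have quad : r.1 * r.2 * side a v = side (~~ a) v * (x * (x + side a v)).
  have sE : s = 2 * side (~~ a) v * x + side a v * side (~~ a) v.
    rewrite prod_side /x; field; rewrite gt_eqF//.
  (* Multiplied by [4 * side (~~ a) v], the equation expresses [s ^+ 2 - (v.1 * v.2) ^+ 2] in two
     ways. *)
  apply: (mulfI (lt0r_neq0 vb)); apply: (@mulfI _ 4); first by rewrite pnatr_eq0.
  move: s2; rewrite sE -(prod_side a v) => s2.
  have -> : 4 * (side (~~ a) v * (r.1 * r.2 * side a v)) =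
    (side a v * side (~~ a) v) ^+ 2 + 4 * (side a v * side (~~ a) v) * (r.1 * r.2)
    - (side a v * side (~~ a) v) ^+ 2 by ring.
  by rewrite -s2; ring.
have y0 : 0 < r.1 * r.2 / x by rewrite divr_gt0.
split.
- by rewrite rhoE; case: (a).
- by rewrite rhoE; case: (a).
- by rewrite -(prod_side a) rhoE side_on_side side_on_sideN; field; rewrite gt_eqF.
- rewrite rhoE side_on_side side_on_sideN.
  have -> : r.1 * r.2 / x * side a v = side (~~ a) v * (x + side a v).
    by apply: (mulfI (lt0r_neq0 x0)); rewrite [RHS]mulrCA -quad; field; rewrite gt_eqF.
  by rewrite mulfK// gt_eqF// addr_gt0.
Qed.

(** [rho] keeps the product of [r] and takes the ratio of [v], which is what the deposit rule
    demands. *)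
Lemma dep_reservesP v r (rho := dep_reserves v r) :
  0 < v.1 -> 0 < v.2 -> 0 < r.1 -> 0 < r.2 ->
  [/\ 0 < rho.1, 0 < rho.2, rho.1 * rho.2 = r.1 * r.2 & rho.2 * v.1 = rho.1 * v.2].
Proof.
move=> v1 v2 r1 r2; rewrite /rho /dep_reserves /=.
have x0 : 0 < v.1 / v.2 * r.1 * r.2 by rewrite !mulr_gt0// invr_gt0.
have y0 : 0 < v.2 / v.1 * r.1 * r.2 by rewrite !mulr_gt0// invr_gt0.
split; rewrite ?sqrtr_gt0//.
- rewrite -sqrtrM ?(ltW x0)//.
  have -> : v.1 / v.2 * r.1 * r.2 * (v.2 / v.1 * r.1 * r.2) = (r.1 * r.2) ^+ 2.
    by field; rewrite !gt_eqF.
  by rewrite sqrtr_sqr ger0_norm// mulr_ge0// ltW.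
- rewrite -{2}(ger0_norm (ltW v1)) -{3}(ger0_norm (ltW v2)) -!sqrtr_sqr.
  rewrite -!sqrtrM ?(ltW x0) ?(ltW y0)//; congr Num.sqrt.
  by field; rewrite !gt_eqF.
Qed.

(** At these reserves the swap pays out just its minimum, so the bound of [tx_gain_ub] is
    attained. *)
Lemma swap_gain H H' A a t v r : sound H -> 0 < r.1 -> 0 < r.2 ->
  (amms H).[? t] = Some (swap_reserves a v r) -> swap_profit P a t v < 0 ->
  effect H (Swap A a t v) = Some H' ->
  slack t (reserves H' t) - slack t (reserves H t) = tx_gain (Swap A a t v).
Proof.
move=> sH r1 r2 tr neg E; rewrite (slack_swap P sH tr E).
have [v1 v2] := andP (effect_valid E).
have [_ _ _ ->] := swap_reservesP a v1 v2 r1 r2.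
by rewrite /= max_r ?oppr_ge0 ?ltW// /swap_profit; ring.
Qed.

Definition is_swap T : bool := if T is Swap _ _ _ _ then true else false.

Lemma step_minted H H' T t : sound H -> (owner T != M) || is_swap T ->
  step H T = Some H' -> bal H' M (inr t) = bal H M (inr t).
Proof.
move=> sH TM E; have [TM'|TM'] := eqVneq (owner T) M; last first.
  have [sg r -> *] := effect_exchange (fun=> 0) sH (stepE E).
  by rewrite bal_set eq_sym (negPf TM').
move: TM E; rewrite TM' eqxx /=; case: T TM' => // A d t' v /= -> _ /stepE /=.
case: (_.[? t']) => [r|]//; case: ifP => // _ /updateP[_ _ ->].
by rewrite bal_set eqxx !creditE/= !addr0.
Qed.

(** Applied to an inner layer, it shows that the adversary ends without minted tokens, so that its
    wallet is a legal initial balance for the remaining game. *)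
Lemma run_minted H H' lam t : sound H ->
  all (fun T => (owner T != M) || is_swap T) lam ->
  run H lam = Some H' -> bal H' M (inr t) = bal H M (inr t).
Proof.
elim: lam H => [H _ _ [<-]//|T lam IH H sH] /= /andP[Ts lams].
rewrite run_cons; case E: (step H T) => [K|]//= rK.
by rewrite (IH _ (sound_step sH E) lams rK) (step_minted _ sH Ts E).
Qed.

Lemma potential_user H H' T : sound H -> owner T != M -> step H T = Some H' ->
  potential H' = potential H +
    (slack (tx_pair T) (reserves H' (tx_pair T)) -
     slack (tx_pair T) (reserves H (tx_pair T))).
Proof. by move=> sH TM E; rewrite (potential_step P M sH E) (negPf TM). Qed.

Lemma potential_front H H' m t r rho T : sound H -> (amms H).[? t] = Some r ->
  rho.1 * rho.2 = r.1 * r.2 -> 0 < side m rho -> owner T != M -> tx_pair T = t ->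
  (forall K, sound K -> (amms K).[? t] = Some rho -> step K T = Some H' ->
    slack t (reserves H' t) - slack t (reserves K t) = tx_gain T) ->
  run H [:: Swap M m t (front_amounts m r rho); T] = Some H' ->
  potential H' = potential H + tx_gain T.
Proof.
move=> sH tr e rho0 TM Tt gT; rewrite run_cons.
case E: (step H _) => [K|]//=; rewrite run_cons; case E': (step K T) => [K'|]//= [EK].
have sK := sound_step sH E.
have aK := front_effect tr e rho0 (stepE E).
rewrite EK in E'; rewrite (potential_user sK TM E') Tt gT//.
  by rewrite (potential_step P M sH E) eqxx addr0.
by rewrite aK fnd_set eqxx.
Qed.

Lemma inner_user_txs H T sg lam : owner T != M -> inner_layer P M H T sg lam ->
  user_txs lam = [::] \/ user_txs lam = [:: T].
Proof.
by move=> TM il; case: il TM => * /=; rewrite /user_txs /= ?eqxx /=;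
  (try rewrite ifT//); auto.
Qed.

Lemma inner_atomic H T sg lam : inner_layer P M H T sg lam -> atomic_balance sg.
Proof.
case=> *; try exact: atomic_bzero; apply: atomic_bsingle; last exact: ltW.
by rewrite front_amounts1 subr_ge0 ltW.
Qed.

Lemma inner_swaps H T sg lam : owner T != M -> inner_layer P M H T sg lam ->
  all (fun T => (owner T != M) || is_swap T) lam.
Proof.
by move=> TM il; case: il TM => * /=; rewrite ?orbT ?andbT//; apply/orP; left.
Qed.

(** Dropped transactions have gain [0]. Otherwise the front swap, if any, keeps the potential, and
    the user transaction attains its bound. *)
Lemma inner_potential H H' T sg lam : sound H -> owner T != M ->
  inner_layer P M H T sg lam -> run (add_wallet H M sg) lam = Some H' ->
  potential H' = potential H + worth (atomic_price P) sg + tx_gain T.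
Proof.
move=> sH TM il.
have sg0 := inner_atomic il.
have sK := sound_add_wallet M sg0 sH.
rewrite -(potential_add_wallet P M H sg0) => rH'.
have [_ lamV] := run_amms sK rH'.
case: il rH' lamV sK TM {sg0} => {T sg lam}.
- by move=> A a t v r tr pf [<-] _ _ _; rewrite /= max_l ?oppr_le0// addr0.
- move=> A a t v r tr pf rhoE; set K := add_wallet _ _ _; rewrite run_cons.
  case E: (step K _) => [K'|]//= [<-] _ sK TM.
  have [r1 r2 _ _ _] := sound_amm sH tr.
  rewrite (potential_user (T := Swap A a t v) sK TM E); congr (_ + _).
  by apply: (swap_gain sK r1 r2 _ pf (stepE E)); rewrite rhoE.
- move=> A a t v r m tr pf _ lt_m; set K := add_wallet _ _ _ => rH' lamV sK TM.
  have /andP[v1 v2] : valid_tx (Swap A a t v).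
    by case: (lamV (Swap A a t v)); rewrite ?inE ?eqxx ?orbT.
  have [r1 r2 _ _ _] := sound_amm sH tr.
  have [rho1 rho2 e _] := swap_reservesP a v1 v2 r1 r2.
  apply: (potential_front (T := Swap A a t v) sK tr e (side_gt0 m rho1 rho2)
    TM (erefl t) _ rH').
  by move=> K' sK' aK' /stepE E; apply: (swap_gain sK' r1 r2 aK' pf E).
- move=> A t v r tr _; set K := add_wallet _ _ _; rewrite run_cons.
  case E: (step K _) => [K'|]//= [<-] _ sK TM.
  rewrite (potential_user (T := Dep A t v) sK TM E); congr (_ + _).
  exact: slack_dep sK (stepE E).
- move=> A t v r m tr _ m1 m2; set K := add_wallet _ _ _ => rH' lamV sK TM.
  have /andP[v1 v2] : valid_tx (Dep A t v).
    by case: (lamV (Dep A t v)); rewrite ?inE ?eqxx ?orbT.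
  have [r1 r2 _ _ _] := sound_amm sH tr.
  have [rho1 rho2 e _] := dep_reservesP v1 v2 r1 r2.
  apply: (potential_front (T := Dep A t v) sK tr e (side_gt0 m rho1 rho2)
    TM (erefl t) _ rH').
  by move=> K' sK' _ /stepE E; apply: (slack_dep P sK' E).
- by move=> A t v r tr [<-] _ _ _; rewrite /= addr0.
Qed.

(** The requested minimum is met with equality, and what is paid out is less than the reserve. *)
Lemma swap_enabled H A a t v r : sound H -> 0 < v.1 -> 0 < v.2 -> 0 < r.1 -> 0 < r.2 ->
  (amms H).[? t] = Some (swap_reserves a v r) ->
  exists H', effect H (Swap A a t v) = Some H'.
Proof.
move=> sH v1 v2 r1 r2 tr; have [rho1 rho2 _ w] := swap_reservesP a v1 v2 r1 r2.
have va := side_gt0 a v1 v2; have vb := side_gt0 (~~ a) v1 v2.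
have ra := side_gt0 a rho1 rho2; have rb := side_gt0 (~~ a) rho1 rho2.
rewrite /= tr va vb w lexx /= /update ifT; first by eexists.
have w0 : 0 < side (~~ a) (swap_reserves a v r) - side (~~ a) v.
  rewrite -w; move: ra rb; set x := side a _; set y := side _ _ => x0 y0.
  have -> : y - y * side a v / (x + side a v) = y * x / (x + side a v).
    by field; rewrite gt_eqF ?addr_gt0.
  by rewrite divr_gt0 ?mulr_gt0 ?addr_gt0.
by rewrite -(valid_side a) side_on_side side_on_sideN w0 addr_gt0.
Qed.

Lemma dep_enabled H A t v r : 0 < v.1 -> 0 < v.2 -> 0 < r.1 -> 0 < r.2 ->
  (amms H).[? t] = Some r -> r.2 * v.1 = r.1 * v.2 ->
  exists H', effect H (Dep A t v) = Some H'.
Proof.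
move=> v1 v2 r1 r2 tr e; rewrite /= tr v1 v2 e eqxx /update /= !addr_gt0//.
by eexists.
Qed.

(** The premise on [step] keeps the user's balance from interfering, also after a front swap; the
    reserves reached by that swap satisfy the other conditions of [T]. *)
Lemma inner_exists H T : sound H -> tx_pair T \in domf (amms H) -> valid_tx T ->
  (forall sg lam H', atomic_balance sg -> user_txs lam = [::] ->
     run (add_wallet H M sg) lam = Some H' -> step H' T = effect H' T) ->
  exists sg lam H',
    inner_layer P M H T sg lam /\ run (add_wallet H M sg) lam = Some H'.
Proof.
move=> sH /fnd_reserves; move: (reserves _ _) => r tr vT suf.
have [r1 r2 _ _ _] := sound_amm sH tr.
have alone : (exists H', effect (add_wallet H M bzero) T = Some H') ->
    exists H', run (add_wallet H M bzero) [:: T] = Some H'.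
  case=> H' E; exists H'; rewrite run_cons (suf bzero [::])// ?E//.
  exact: atomic_bzero.
have front rho m : 0 < rho.1 -> 0 < rho.2 -> rho.1 * rho.2 = r.1 * r.2 ->
    side m r < side m rho ->
    (forall K, sound K -> (amms K).[? tx_pair T] = Some rho ->
      exists H', effect K T = Some H') ->
    let u := front_amounts m r rho in
    exists H', run (add_wallet H M (bsingle (inl (side m (tx_pair T))) (side m u)))
      [:: Swap M m (tx_pair T) u; T] = Some H'.
  move=> rho1 rho2 e lt_m en u.
  have [K rK aK] := front_run M sH tr e rho1 rho2 lt_m.
  have at0 : atomic_balance (bsingle (inl (side m (tx_pair T))) (side m u)).
    by apply: atomic_bsingle; rewrite front_amounts1 subr_ge0 ltW.
  have sK : sound K by apply: sound_run rK; apply: sound_add_wallet.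
  have aK' : (amms K).[? tx_pair T] = Some rho by rewrite aK fnd_set eqxx.
  have [H' E] := en K sK aK'; exists H'.
  rewrite -cat1s run_cat rK /= run_cons (suf _ _ _ at0 _ rK) ?E//.
  by rewrite /user_txs /= eqxx.
have le_other m rho : 0 < rho.1 -> 0 < rho.2 -> rho.1 * rho.2 = r.1 * r.2 ->
    side m r < side m rho -> 0 < side (~~ m) (front_amounts m r rho).
  move=> rho1 rho2 e lt_m; rewrite front_amounts2 subr_gt0.
  rewrite -(ltr_pM2l (side_gt0 m r1 r2)) prod_side -e -(prod_side m).
  by rewrite ltr_pM2r// side_gt0.
(* Between distinct reserves with equal products one side must grow, which gives the index of the
   front swap. *)
have pick rho : 0 < rho.1 -> 0 < rho.2 -> rho.1 * rho.2 = r.1 * r.2 -> rho <> r ->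
    exists m, side m r < side m rho.
  move=> rho1 rho2 e ne; have [lt1|ge1] := ltP r.1 rho.1; first by exists false.
  exists true; rewrite /= ltNge; apply/negP => ge2; apply: ne.
  have e1 : rho.1 = r.1.
    apply/eqP; rewrite eq_le ge1 -(ler_pM2r r2) -e ler_pM2l//.
  apply: injective_projections => //; apply: (mulfI (lt0r_neq0 rho1)).
  by rewrite e e1.
case: T tr vT suf alone front => [A t v|A a t v|A t v] /= tr vT suf alone front.
- case/andP: vT => v1 v2.
  have [rho1 rho2 e ed] := dep_reservesP v1 v2 r1 r2.
  have [eq_v|/eqP ne_v] := eqVneq (v.1 / v.2) (r.1 / r.2).
    have [|H' rH'] := alone.
      apply: (dep_enabled (H := add_wallet H M bzero) A v1 v2 r1 r2 tr).
      have -> : v.1 = v.1 / v.2 * v.2 by rewrite divfK// gt_eqF.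
      by rewrite eq_v; field; rewrite gt_eqF.
    by exists bzero, [:: Dep A t v], H'; split=> //; apply: (InnerDepAlone _ _ _ tr).
  have [|m lt_m] := pick _ rho1 rho2 e.
    move=> er; apply: ne_v; rewrite er in ed.
    by apply/eqP; rewrite eqr_div ?lt0r_neq0// mulrC ed.
  have [|H' rH'] := front _ m rho1 rho2 e lt_m.
    by move=> K sK aK; apply: dep_enabled aK _.
  do 3!eexists; split; last exact: rH'; apply: (InnerDepFront _ _ _ tr) => //.
    by rewrite front_amounts1 subr_gt0.
  exact: le_other.
- case/andP: vT => v1 v2.
  have [rho1 rho2 e _] := swap_reservesP a v1 v2 r1 r2.
  have [pos|neg] := lerP 0 (swap_profit P a t v).
    do 3!eexists; split; first exact: (InnerSwapDrop _ _ tr).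
    by [].
  have [er|/eqP ne] := eqVneq (swap_reserves a v r) r.
    have [|H' rH'] := alone.
      by apply: (swap_enabled A (H := add_wallet H M bzero) _ v1 v2 r1 r2);
        rewrite ?er//; apply: sound_add_wallet => //; apply: atomic_bzero.
    do 3!eexists; split; last exact: rH'.
    exact: (InnerSwapAlone _ _ tr).
  have [m lt_m] := pick _ rho1 rho2 e ne.
  have [|H' rH'] := front _ m rho1 rho2 e lt_m.
    by move=> K sK aK; apply: swap_enabled aK.
  by do 3!eexists; split; last exact: rH'; apply: (InnerSwapFront _ _ tr).
- do 3!eexists; split; first exact: (InnerRdm _ _ _ _ tr).
  by [].
Qed.

End InnerLayer.

(** * Rebalancing all AMMs *)

Section FinalLayer.
Variables (R : realType) (U T0 : choiceType) (P : T0 -> R) (M : U).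
Hypothesis P_ge0 : forall a, 0 <= P a.
Implicit Types (H : state R U T0) (t : T0 * T0) (r v : R * R)
  (F : T0 * T0 -> balance R T0 * seq (tx R U T0)) (rho : T0 * T0 -> R * R).

Local Notation slack := (slack P).
Local Notation potential := (potential P M).
Local Notation user_txs := (user_txs M).

(** A relocation touches one AMM only, so swaps computed from the initial reserves remain correct.
    [F] is a parameter so that the fold also covers [final_layer]. *)
Lemma relocate_all H F rho ts : sound H -> uniq ts ->
  (forall t, t \in ts -> [/\ t \in domf (amms H), 0 < (rho t).1, 0 < (rho t).2,
     (rho t).1 * (rho t).2 = (reserves H t).1 * (reserves H t).2 &
     F t = relocate M t (reserves H t) (rho t)]) ->
  let mv := foldr (fun t mv => (badd (F t).1 mv.1, (F t).2 ++ mv.2)) (bzero, [::]) ts in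
  [/\ atomic_balance mv.1, user_txs mv.2 = [::] &
   exists2 H', run (add_wallet H M mv.1) mv.2 = Some H' &
     forall t, (amms H').[? t] = if t \in ts then Some (rho t) else (amms H).[? t]].
Proof.
elim: ts H => [|t ts IH] H sH.
  move=> _ _; split=> //; first exact: atomic_bzero.
  by exists (add_wallet H M bzero).
move=> /= /andP[tts uts] Fts.
have [tH rho1 rho2 e Ft] := Fts t (mem_head _ _).
have [] := relocateP M sH (fnd_reserves tH) e rho1 rho2.
rewrite -Ft => sg0 u0 [K rK aK].
have sK : sound K := sound_run (sound_add_wallet M sg0 sH) rK.
have tsK t' : t' \in ts -> t' != t by move=> t'ts; apply: contraNneq tts => <-.
have [|sg1 u1 [H' rH' aH']] := IH K sK uts.
  move=> t' t'ts; have [] := Fts t'; first by rewrite in_cons t'ts orbT.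
  have rt' : reserves K t' = reserves H t'.
    by rewrite /reserves aK (negPf (tsK _ t'ts)).
  rewrite rt' => t'H ? ? ? ?; split=> //.
  by move: (aK t'); rewrite (negPf (tsK _ t'ts)) (fnd_reserves t'H) => /fnd_dom.
split; first exact: atomic_badd.
  by rewrite user_txs_cat u0 u1.
exists H'; first exact: run_add_cat sg1 rK rH'.
move=> t'; rewrite aH' in_cons aK; case: ifP => [/tsK/negPf -> //|_].
by rewrite orbF; case: eqP => [->|].
Qed.

(** The reserves minimizing the value for a given product. *)
Definition best_reserves t r : R * R :=
  (Num.sqrt (P t.2 / P t.1 * r.1 * r.2), Num.sqrt (P t.1 / P t.2 * r.1 * r.2)).

Lemma best_reservesP t r (rho := best_reserves t r) :
  0 < P t.1 -> 0 < P t.2 -> 0 < r.1 -> 0 < r.2 ->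
  [/\ 0 < rho.1, 0 < rho.2, rho.1 * rho.2 = r.1 * r.2 & slack t rho = 0].
Proof.
move=> p1 p2 r1 r2; rewrite /rho /=.
(* These are the deposit reserves for amounts in the ratio of the exchanged prices: both reserves
   then have equal value, the equality case of AM-GM. *)
have [h1 h2 e ed] := dep_reservesP (v := (P t.2, P t.1)) p2 p1 r1 r2.
split=> //; apply/eqP; rewrite subr_eq0 /floor_value e; apply/eqP.
rewrite /value; rewrite [_ * P t.2]ed.
have -> : Num.sqrt (P t.2 / P t.1 * r.1 * r.2) * P t.1 =
    Num.sqrt (r.1 * r.2 * (P t.1 * P t.2)).
  rewrite -{2}(ger0_norm (ltW p1)) -sqrtr_sqr -sqrtrM.
    by congr Num.sqrt; field; rewrite gt_eqF.
  by rewrite !mulr_ge0 ?invr_ge0// ltW.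
by rewrite mulr2n mulrDl mul1r.
Qed.

(** If one of the prices is zero, the value has no minimum for a given product,
    but it comes arbitrarily close to its infimum. *)
Definition near_reserves (eps : R) t r : R * R :=
  if P t.1 == 0 then (r.1 * r.2 / (eps / (1 + P t.2)), eps / (1 + P t.2))
  else if P t.2 == 0 then (eps / (1 + P t.1), r.1 * r.2 / (eps / (1 + P t.1)))
  else best_reserves t r.

Lemma near_reservesP eps t r (rho := near_reserves eps t r) :
  0 < eps -> 0 < r.1 -> 0 < r.2 ->
  [/\ 0 < rho.1, 0 < rho.2, rho.1 * rho.2 = r.1 * r.2 & slack t rho <= eps].
Proof.
move=> eps0 r1 r2; rewrite /rho /near_reserves.
have k0 : 0 < r.1 * r.2 by rewrite mulr_gt0.
(* The summand [1] keeps the denominator positive when both prices vanish, and still bounds the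
   remaining value by [eps]. *)
have D0 a : 0 < 1 + P a by rewrite ltr_pwDl.
have x0 a : 0 < eps / (1 + P a) by rewrite divr_gt0.
have xP a : eps / (1 + P a) * P a <= eps.
  rewrite -mulrA ger_pMr// mulrC ler_pdivrMr// mul1r lerDr//.
have [p1|p1] := eqVneq (P t.1) 0; last have [p2|p2] := eqVneq (P t.2) 0.
- split=> //=; rewrite ?divr_gt0 ?divfK ?gt_eqF//.
  by rewrite /slack /value /floor_value p1 mul0r !mulr0 sqrtr0 mulr0 subr0 add0r xP.
- split=> /=; [exact: x0|by rewrite divr_gt0| |].
    by rewrite mulrCA mulfV ?mulr1// gt_eqF.
  by rewrite /slack /value /floor_value p2 !mulr0 sqrtr0 mulr0 subr0 addr0 xP.
- have [||||-> -> -> ->] := @best_reservesP t r => //; rewrite ?lt_def ?p1 ?p2 ?P_ge0//.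
  by split=> //; apply: ltW.
Qed.

Lemma near_optimal_finish H eps : sound H -> 0 < eps ->
  exists sg lam H', [/\ atomic_balance sg, user_txs lam = [::],
    run (add_wallet H M sg) lam = Some H' & potential H' - eps <= net_worth P M H'].
Proof.
move=> sH eps0.
(* Each AMM may lose an equal part of [eps]; [n.+1] avoids a zero denominator when there is none. *)
pose n := size (domf (amms H)); pose e := eps / n.+1%:R.
have e0 : 0 < e by rewrite divr_gt0.
pose rho t := near_reserves e t (reserves H t).
pose F t := relocate M t (reserves H t) (rho t).
have rhoP t : t \in domf (amms H) ->
  [/\ 0 < (rho t).1, 0 < (rho t).2, (rho t).1 * (rho t).2 =
      (reserves H t).1 * (reserves H t).2 & slack t (rho t) <= e].
  move=> tH; have [r1 r2 _ _ _] := sound_amm sH (fnd_reserves tH).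
  exact: near_reservesP.
have := @relocate_all H F rho (domf (amms H)) sH (fset_uniq _).
case=> [t tH|]; first by have [] := rhoP t tH.
set mv := foldr _ _ _ => sg0 u0 [H' rH' aH'].
exists mv.1, mv.2, H'; split=> //.
have sH' : sound H' := sound_run (sound_add_wallet M sg0 sH) rH'.
rewrite (potentialE P M sH') lerBlDr lerD2l.
have dE : domf (amms H') = domf (amms H).
  apply/fsetP => t; apply/idP/idP.
    by move/fnd_reserves; rewrite aH'; case: ifP => // tH /fnd_dom; rewrite tH.
  by move=> tH; move: (aH' t); rewrite tH => /fnd_dom.
rewrite dE; apply: (@le_trans _ _ (\sum_(t <- domf (amms H)) e)).
  rewrite big_seq [leRHS]big_seq; apply: ler_sum => t tH.
  have [rho1 rho2 _ le_e] := rhoP t tH.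
  have -> : reserves H' t = rho t by rewrite /reserves aH' tH.
  have /andP[s0 s1] := users_share_ge0 M t sH'.
  apply: le_trans le_e; rewrite ler_piMl// slack_ge0// ltW//.
rewrite big_const_seq count_predT iter_addr_0 -/n -(mulr_natr e) /e mulrAC ler_pdivrMr//.
by rewrite ler_pM2l// ler_nat.
Qed.

(** By the constant product rule, the output in [final_swap] is the drop of the other reserve, so
    the final layer is a list of relocations. *)
Lemma final_ammE H t (r := reserves H t) :
  0 < P t.1 -> 0 < P t.2 -> 0 < r.1 -> 0 < r.2 ->
  final_amm P M H t = relocate M t r (best_reserves t r).
Proof.
move=> p1 p2 r1 r2; have [h1 h2 e _] := best_reservesP p1 p2 r1 r2.
have sw d : final_swap P M r t d =
    (bsingle (inl (side d t)) (side d (front_amounts d r (best_reserves t r))),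
     [:: Swap M d t (front_amounts d r (best_reserves t r))]).
  have w : final_amount P r t d = side d (front_amounts d r (best_reserves t r)).
    by rewrite front_amounts1; case: d.
  rewrite /final_swap w front_out ?(side_gt0 d h1 h2)//.
  by rewrite front_amounts1.
by rewrite /final_amm -/r !sw /relocate /final_amount !subr_gt0.
Qed.

Lemma final_layerP H ts : sound H -> perm_eq ts (domf (amms H)) ->
  (forall t, t \in domf (amms H) -> P t.1 != 0 /\ P t.2 != 0) ->
  let mv := final_layer P M H ts in
  [/\ atomic_balance mv.1, user_txs mv.2 = [::] &
   exists2 H', run (add_wallet H M mv.1) mv.2 = Some H' &
     net_worth P M H' = potential H'].
Proof.
move=> sH tsH P0; rewrite /final_layer.
have tsE t : t \in ts -> t \in domf (amms H) by rewrite (perm_mem tsH).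
pose rho t := best_reserves t (reserves H t).
have rhoP t : t \in domf (amms H) ->
  [/\ 0 < (rho t).1, 0 < (rho t).2, (rho t).1 * (rho t).2 =
      (reserves H t).1 * (reserves H t).2, slack t (rho t) = 0 &
      final_amm P M H t = relocate M t (reserves H t) (rho t)].
  move=> tH; have [r1 r2 _ _ _] := sound_amm sH (fnd_reserves tH).
  have [p1 p2] := P0 t tH.
  have p1' : 0 < P t.1 by rewrite lt_def p1 P_ge0.
  have p2' : 0 < P t.2 by rewrite lt_def p2 P_ge0.
  by have [? ? ? ?] := best_reservesP p1' p2' r1 r2; split=> //; apply: final_ammE.
have := @relocate_all H (final_amm P M H) rho ts sH.
rewrite (perm_uniq tsH) fset_uniq => /(_ isT)[].
  by move=> t /tsE tH; have [] := rhoP t tH.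
set mv := foldr _ _ _ => sg0 u0 [H' rH' aH']; split=> //; exists H' => //.
have sH' : sound H' := sound_run (sound_add_wallet M sg0 sH) rH'.
rewrite (potentialE P M sH') big_seq_cond big1 ?addr0// => t.
rewrite andbT => /fnd_reserves tH'; move: (aH' t); rewrite (perm_mem tsH) tH'.
case: ifP => [tH [->]|tH /esym/fnd_dom]; last by rewrite tH.
by have [_ _ _ ->] := rhoP t tH; rewrite mulr0.
Qed.

End FinalLayer.

(** * Optimality of the layers *)

Section Optimality.
Variables (R : realType) (U T0 : choiceType) (P : T0 -> R) (M : U).
Hypothesis P_ge0 : forall a, 0 <= P a.
Implicit Types (H G : state R U T0) (t : T0 * T0) (T : tx R U T0)
  (S lam : seq (tx R U T0)) (sg : balance R T0) (f g : tx R U T0 -> nat).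

Local Notation atomic_price := (atomic_price P).
Local Notation tx_gain := (tx_gain P).
Local Notation potential := (potential P M).
Local Notation user_txs := (user_txs M).

(** [sufficient_balances], with multiplicities [f], for a state in which the
    adversary may already have a wallet. *)
Definition sufficient H f : Prop :=
  forall sg lam T H', atomic_balance sg ->
    (forall x, (count_mem x (T :: user_txs lam) <= f x)%N) ->
    run (add_wallet H M sg) lam = Some H' -> step H' T = effect H' T.

Lemma sufficient_run H H1 sg1 lam1 f g :
  sufficient H f -> atomic_balance sg1 ->
  run (add_wallet H M sg1) lam1 = Some H1 ->
  (forall x, (count_mem x (user_txs lam1) + g x <= f x)%N) -> sufficient H1 g.
Proof.
move=> suf sg10 r1 fg sg lam T H' sg0 cnt r.
apply: (suf _ _ T H' (atomic_badd sg10 sg0) _ (run_add_cat sg0 r1 r)) => x.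
apply: leq_trans (fg x); rewrite user_txs_cat /= count_cat addnCA leq_add2l.
exact: cnt.
Qed.

(** Being a move of the adversary, a creation changes the potential only by the funds brought in.
    The amounts [1] are arbitrary, and an existing AMM is left alone. *)
Lemma create_amm H t : sound H -> t.1 != t.2 -> (t.2, t.1) \notin domf (amms H) ->
  exists sg lam H', [/\ atomic_balance sg, user_txs lam = [::],
    run (add_wallet H M sg) lam = Some H' &
    domf (amms H') = (t |` domf (amms H))%fset].
Proof.
move=> sH t12 tN; have [tH|tH] := boolP (t \in domf (amms H)).
  exists bzero, [::], (add_wallet H M bzero); split=> //; first exact: atomic_bzero.
  apply/fsetP => t'; rewrite !inE; case: eqP => [->|//]; exact: tH.
pose sg : balance R T0 := badd (bsingle (inl t.1) 1) (bsingle (inl t.2) 1).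
have sg0 : atomic_balance sg by apply: atomic_badd; apply: atomic_bsingle.
have sK := sound_add_wallet M sg0 sH.
set K := add_wallet _ _ _ in sK.
have [H' E] : exists H', step K (Dep M t (1, 1)) = Some H'.
  rewrite /step /= bal_add_wallet eqxx !baddE !bsingleE !eqxx.
  rewrite !(inj_eq (@inl_inj _ _)) [t.2 == _]eq_sym (negPf t12) addr0 add0r.
  rewrite !lerDr !(sound_bal sH) ltr01 not_fnd//= tN /update /= ltr01.
  by eexists.
exists sg, [:: Dep M t (1, 1)], H'; split=> //.
  by rewrite /user_txs /= eqxx.
exact: step_amms sK E.
Qed.

Lemma run_amms_sub (Q : {fset T0 * T0}) H H' lam : sound H ->
  run H lam = Some H' -> (domf (amms H) `<=` Q)%fset ->
  (forall T, T \in lam -> tx_pair T \in Q) -> (domf (amms H') `<=` Q)%fset.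
Proof.
elim: lam H => [H _ [<-]//|T lam IH H sH].
rewrite run_cons; case E: (step H T) => [K|]//= rK HQ lamQ.
apply: (IH _ (sound_step sH E) rK) => [|T' T'lam].
  by rewrite (step_amms sH E) fsubUset fsub1set HQ lamQ ?mem_head.
by apply: lamQ; rewrite in_cons T'lam orbT.
Qed.

Lemma inner_pair H T sg lam : inner_layer P M H T sg lam ->
  {in lam, forall T', tx_pair T' = tx_pair T}.
Proof.
move=> il; suff /allP pl : all (fun T' => tx_pair T' == tx_pair T) lam.
  by move=> T' /pl/eqP.
by case: il => *; rewrite /= ?eqxx.
Qed.

Lemma inner_amm H T sg lam : inner_layer P M H T sg lam -> tx_pair T \in domf (amms H).
Proof. by case=> *; apply/fnd_dom; eassumption. Qed.

Lemma inner_gain_ge0 H H' T sg lam : sound H -> inner_layer P M H T sg lam ->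
  run (add_wallet H M sg) lam = Some H' -> 0 <= tx_gain T.
Proof.
move=> sH il; have sg0 := inner_atomic il.
move/(run_amms (sound_add_wallet M sg0 sH)) => [_ lamV].
(* A deposit always belongs to its inner layer, so the execution shows that its amounts are
   positive. *)
have : is_true (if T is Dep _ _ _ then T \in lam else true).
  by case: il {lamV} => *; rewrite // !inE eqxx ?orbT.
case: T il => [A t v|A a t v|A t v] _ /=; last by [].
  by move/lamV => [+ _]; apply: tx_gain_ge0.
by rewrite le_max lexx.
Qed.

(** [Q] will be the AMMs at the end of a competing move that plays [S]. As [Q] has no pair in both
    orders, staying inside it allows creating every AMM that [S] needs; inner layers then realise
    each gain in full, in any order. *)
Lemma play_all (Q : {fset T0 * T0}) S H : sound H ->
  (forall t, t \in Q -> t.1 != t.2 /\ (t.2, t.1) \notin Q) ->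
  (domf (amms H) `<=` Q)%fset ->
  (forall T, T \in S -> [/\ valid_tx T, tx_pair T \in Q & owner T != M]) ->
  sufficient H (fun x => count_mem x S) ->
  exists sg lam H', [/\ atomic_balance sg,
    forall x, (count_mem x (user_txs lam) <= count_mem x S)%N,
    run (add_wallet H M sg) lam = Some H' &
    potential H' = potential H + worth atomic_price sg + \sum_(T <- S) tx_gain T].
Proof.
move=> sH QP; elim: S H sH => [|T S IH] H sH HQ SP suf.
  exists bzero, [::], (add_wallet H M bzero); split=> //; first exact: atomic_bzero.
  by rewrite big_nil addr0 potential_add_wallet//; apply: atomic_bzero.
have [vT tQ TM] := SP T (mem_head _ _); have [t12 tN] := QP _ tQ.
have tNH : ((tx_pair T).2, (tx_pair T).1) \notin domf (amms H).
  by apply: contra tN; apply: (fsubsetP HQ).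
have [sg1 [lam1 [H1 [sg10 u1 r1 d1]]]] := create_amm sH t12 tNH.
have sH1 : sound H1 := sound_run (sound_add_wallet M sg10 sH) r1.
have suf1 : sufficient H1 (fun x => count_mem x (T :: S)).
  by apply: (sufficient_run suf sg10 r1) => x; rewrite u1.
have tH1 : tx_pair T \in domf (amms H1) by rewrite d1 fset1U1.
have [|sg2 [lam2 [H2 [il r2]]]] := inner_exists P (M := M) sH1 tH1 vT.
  move=> sg lam H' sg0 u r; apply: (suf1 sg lam) => // x.
  by rewrite u /= leq_add2l.
have sg20 := inner_atomic il.
have sK1 := sound_add_wallet M sg20 sH1.
have sH2 : sound H2 := sound_run sK1 r2.
have u2 x : (count_mem x (user_txs lam2) <= (T == x))%N.
  by case: (inner_user_txs TM il) => -> //=; rewrite addn0.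
have suf2 : sufficient H2 (fun x => count_mem x S).
  by apply: (sufficient_run suf1 sg20 r2) => x /=; rewrite leq_add2r.
have H2Q : (domf (amms H2) `<=` Q)%fset.
  apply: (run_amms_sub sK1 r2) => [|T' /(inner_pair il) -> //].
  by rewrite d1 fsubUset fsub1set tQ.
have [|sg3 [lam3 [H3 [sg30 u3 r3 p3]]]] := IH H2 sH2 H2Q _ suf2.
  by move=> T' T'S; apply: SP; rewrite in_cons T'S orbT.
exists (badd sg1 (badd sg2 sg3)), (lam1 ++ (lam2 ++ lam3)), H3; split.
- by do 2!apply: atomic_badd => //.
- by move=> x; rewrite !user_txs_cat u1 /= count_cat leq_add.
- by apply: run_add_cat r1 _; [apply: atomic_badd|apply: run_add_cat r2 r3].
- rewrite p3 (inner_potential sH1 TM il r2).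
  rewrite (potential_run_adversary P (sound_add_wallet M sg10 sH) u1 r1).
  rewrite potential_add_wallet// !worth_badd big_cons; ring.
Qed.

Lemma net_worth_set G sg : M \notin domf (wallets G) -> atomic_balance sg ->
  net_worth P M (set_wallet G M sg) = worth atomic_price sg.
Proof.
move=> MG sg0; rewrite -add_wallet_fresh// net_worth_add_wallet//.
by rewrite /net_worth bal_notin// -/(worth _ bzero) worth_bzero add0r.
Qed.

Lemma gain_run G sg lam H : M \notin domf (wallets G) -> atomic_balance sg ->
  run (set_wallet G M sg) lam = Some H ->
  gain P M (set_wallet G M sg) lam = net_worth P M H - worth atomic_price sg.
Proof. by move=> MG sg0 r; rewrite /gain r net_worth_set. Qed.

Lemma net_worth_le_potential H : sound H -> net_worth P M H <= potential H.
Proof.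
move=> sH; rewrite (potentialE P M sH) lerDl big_seq sumr_ge0// => t tH.
have [r1 r2 _ _ _] := sound_amm sH (fnd_reserves tH).
have /andP[s0 _] := users_share_ge0 M t sH.
by rewrite mulr_ge0// slack_ge0// ltW.
Qed.

(** The initial funds cancel, since they enter the potential at their worth. *)
Lemma gain_ub G sg lam H : sound G -> M \notin domf (wallets G) ->
  atomic_balance sg -> run (set_wallet G M sg) lam = Some H ->
  gain P M (set_wallet G M sg) lam <=
  potential G + \sum_(T <- user_txs lam) tx_gain T.
Proof.
move=> sG MG sg0 r; rewrite (gain_run MG sg0 r) lerBlDr.
move: r; rewrite -add_wallet_fresh// => r.
have sK := sound_add_wallet M sg0 sG.
apply: le_trans (net_worth_le_potential (sound_run sK r)) _.
apply: le_trans (potential_run M P_ge0 sK r) _.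
by rewrite potential_add_wallet// addrAC.
Qed.

(** With no user transaction the bound of [gain_ub] is [potential G], and the final layer leaves no
    slack between potential and net worth. *)
Lemma solution_final G X ts : sound G -> M \notin domf (wallets G) ->
  X = mset0 -> (forall t, t \in domf (amms G) -> P t.1 != 0 /\ P t.2 != 0) ->
  perm_eq ts (domf (amms G)) -> solution P M G X (final_layer P M G ts).
Proof.
move=> sG MG -> P0 tsG.
have [sg0 u0 [H' rH' nwH']] := final_layerP M P_ge0 sG tsG P0.
have sK := sound_add_wallet M sg0 sG.
have pH' := potential_run_adversary P sK u0 rH'.
move: rH'; rewrite add_wallet_fresh// => rH'.
split; first by split; rewrite ?u0 ?rH'//; apply/msubsetP => x; rewrite mset_seqE.
case=> sg lam [/= sg1 lamX]; case r: (run _ lam) => [K|]// _.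
apply: le_trans (gain_ub sG MG sg1 r) _.
have -> : user_txs lam = [::].
  case: (user_txs lam) lamX => // T l /msubsetP/(_ T).
  by rewrite mset_seqE mset0E /= eqxx.
rewrite big_nil addr0 (gain_run MG sg0 rH') nwH' pH' potential_add_wallet//.
by rewrite addrK.
Qed.

(** A competing move gains at most [potential G] plus the gains of [T] and of its other user
    transactions [S]. The inner layer realises the gain of [T], and some move of the remaining game
    realises the rest up to [eps], which the given solution at least matches. *)
Lemma solution_inner G X T X' sg lam G' sgM sg' lam' :
  sound G -> M \notin domf (wallets G) -> (forall T, T \in X -> owner T != M) ->
  sufficient_balances M G X -> X = [mset T] `+` X' ->
  inner_layer P M G T sg lam -> M \notin domf (wallets G') ->
  run (set_wallet G M sg) lam = Some (set_wallet G' M sgM) ->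
  solution P M G' X' (sg', lam') ->
  solution P M G X (badd sg sg', lam ++ lam').
Proof.
move=> sG MG XM suf XE il MG' r [[/= sg'0 lam'X']].
case r': (run _ lam') => [H'|]// _ opt'.
have TM : owner T != M by apply: XM; rewrite XE in_msetD in_mset1 eqxx.
have XS x : X x = ((x == T) + X' x)%N by rewrite XE mset1DE.
have sg0 := inner_atomic il.
have sK := sound_add_wallet M sg0 sG.
move: (r); rewrite -add_wallet_fresh// => rK.
have sK' := sound_run sK rK.
have balM : bal (set_wallet G' M sgM) M = sgM by rewrite bal_set eqxx.
have sgM0 : atomic_balance sgM.
  split; first by move=> x; rewrite -balM (sound_bal sK').
  move=> t; rewrite -balM (run_minted _ sK (inner_swaps TM il) rK).
  by rewrite bal_add_wallet eqxx bal_notin// add0b; case: sg0.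
have usr := inner_user_txs TM il.
have pK' := inner_potential sG TM il rK.
have ssg'0 := atomic_badd sg0 sg'0.
(* [sg'] lies idle during [lam], and [sgM] during [lam']. *)
have rr' : run (set_wallet G M (badd sg sg')) (lam ++ lam') =
    Some (add_wallet H' M sgM).
  rewrite -add_wallet_set run_cat (run_add_wallet _ sg'0 r)/=.
  by rewrite add_wallet_set baddC -add_wallet_set (run_add_wallet _ sgM0 r').
split.
  split; rewrite ?rr'//; apply/msubsetP => x.
  rewrite mset_seqE /= user_txs_cat count_cat XS leq_add//.
    by case: usr => -> //=; rewrite addn0 eq_sym.
  by move/msubsetP/(_ x): lam'X'; rewrite mset_seqE.
case=> sg3 lam3 [/= sg30 lam3X]; case r3: (run _ lam3) => [H3|]// _.
(* The competing move may not contain [T]; then [rem] changes nothing, and [gS] below uses that the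
   gain of [T] is nonnegative. *)
pose S := rem T (user_txs lam3).
have r3' := r3; rewrite -add_wallet_fresh// in r3'.
have sK3 := sound_add_wallet M sg30 sG.
have sH3 := sound_run sK3 r3'.
have [GH3 lam3P] := run_amms sK3 r3'.
have cntS x : (count_mem x S <= X' x)%N.
  move/msubsetP/(_ x): lam3X; rewrite mset_seqE XS /S.
  have [Tin|Tin] := boolP (T \in user_txs lam3).
    by rewrite (permP (perm_to_rem Tin)) /= eq_sym leq_add2l.
  rewrite rem_id//; case: (x =P T) => [->|]//.
  by rewrite (count_memPn Tin).
have gS : \sum_(T <- user_txs lam3) tx_gain T <= tx_gain T + \sum_(T <- S) tx_gain T.
  have [Tin|Tin] := boolP (T \in user_txs lam3).
    by rewrite (perm_big _ (perm_to_rem Tin)) big_cons.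
  by rewrite /S rem_id// lerDr (inner_gain_ge0 sG il rK).
have SP T' : T' \in S -> [/\ valid_tx T', tx_pair T' \in domf (amms H3) & owner T' != M].
  move/mem_rem; rewrite mem_filter => /andP[T'M /lam3P[? ?]].
  by split.
have QP t : t \in domf (amms H3) -> t.1 != t.2 /\ (t.2, t.1) \notin domf (amms H3).
  by move/fnd_reserves/(sound_amm sH3) => [].
have sufG : sufficient G X.
  move=> sg1 lam1 T1 H1 sg10 cnt r1; apply: (suf sg1 lam1) => //.
    by apply/msubsetP => x; rewrite mset_seqE.
  by rewrite -add_wallet_fresh.
have sufK' : sufficient (set_wallet G' M sgM) (fun x => count_mem x S).
  apply: (sufficient_run sufG sg0 rK) => x; rewrite XS leq_add//.
  by case: usr => -> //=; rewrite addn0 eq_sym.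
have K'H3 : (domf (amms (set_wallet G' M sgM)) `<=` domf (amms H3))%fset.
  apply: (run_amms_sub sK rK GH3) => T' /(inner_pair il) ->.
  exact: (fsubsetP GH3) (inner_amm il).
apply: le_trans (gain_ub sG MG sg30 r3) _.
apply/ler_addgt0Pr => eps eps0.
(* The comparison move plays [S] by inner layers, with the AMMs of [H3] as [Q], and then rebalances
   within [eps]. *)
have [sg4 [lam4 [H4 [sg40 cnt4 r4 p4]]]] := play_all sK' QP K'H3 SP sufK'.
have sH4 : sound H4 := sound_run (sound_add_wallet M sg40 sK') r4.
have [sg5 [lam5 [H5 [sg50 u5 r5 p5]]]] := near_optimal_finish M P_ge0 sH4 eps0.
have r45 := run_add_cat sg50 r4 r5.
have sg450 := atomic_badd sg40 sg50.
(* The comparison run starts with [sgM] in the wallet, so [sgM] is part of the initial balance of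
   this move. *)
have sg6 := atomic_badd sgM0 sg450.
rewrite add_wallet_set in r45.
have /opt' /= : is_move M G' X' (badd sgM (badd sg4 sg5), lam4 ++ lam5).
  split=> //=; last by rewrite r45.
  apply/msubsetP => x; rewrite mset_seqE user_txs_cat u5 cats0.
  exact: leq_trans (cnt4 x) (cntS x).
rewrite (gain_run MG' sg6 r45) (gain_run MG' sg'0 r') (gain_run MG ssg'0 rr').
rewrite net_worth_add_wallet// !worth_badd.
have := potential_run_adversary P (sound_add_wallet M sg50 sH4) u5 r5.
rewrite potential_add_wallet// p4 pK' => p5'.
move: p5 gS; rewrite p5'; lra.
Qed.

End Optimality.

Theorem theorem2 (R : realType) (U T0 : choiceType) (P : T0 -> R) (M : U)
    (G : state R U T0) (X : {mset tx R U T0})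
    (P_ge0 : forall a, 0 <= P a)
    (G_reachable : reachable G)
    (M_fresh : M \notin domf (wallets G))
    (X_users : forall T, T \in X -> owner T != M)
    (G_sufficient : sufficient_balances M G X) :
  (X = mset0 ->
   (forall t, t \in domf (amms G) -> P t.1 != 0 /\ P t.2 != 0) ->
   forall ts, perm_eq ts (domf (amms G)) ->
     solution P M G X (final_layer P M G ts))
  /\
  (forall (T : tx R U T0) (X' : {mset tx R U T0})
          (sg : balance R T0) (lam : seq (tx R U T0))
          (G' : state R U T0) (sgM : balance R T0)
          (sg' : balance R T0) (lam' : seq (tx R U T0)),
     X = [mset T] `+` X' ->
     inner_layer P M G T sg lam ->
     M \notin domf (wallets G') ->
     run (set_wallet G M sg) lam = Some (set_wallet G' M sgM) ->
     solution P M G' X' (sg', lam') ->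
     solution P M G X (badd sg sg', lam ++ lam')).
Proof.
have sG := sound_reachable G_reachable.
split=> [X0 P0 ts tsG|T X' sg lam G' sgM sg' lam' XE il MG' r sol].
  exact: solution_final.
exact: solution_inner XE il MG' r sol.
Qed.
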